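(* Let $N\geq 4$ be an integer, and let $A,B,C,R=BC$ be the $4\times 4$ real matrices, $\mathcal{C}_k,\mathcal{C}_k'$ $(k=0,\ldots,N-1)$ the simplicial cones in $\mathbb{R}^4$, and $P\tilde\Gamma_N$ the projective group defined in the context. Consider the $2N$ projective cones $\mathbb{P}\mathcal{C}_k,\mathbb{P}\mathcal{C}_k'\subset \mathbb{P}(\mathbb{R}^4)$ for $k=0,\ldots,N-1$. (1) The interiors of distinct cones among these are disjoint. (2) For any of these cones $\mathbb{P}\mathcal{C}$ except $\mathbb{P}\mathcal{C}_0$, we have $A\cdot \mathbb{P}\mathcal{C}\subset \mathbb{P}\mathcal{C}_0$. Therefore, as a group, $$P\tilde\Gamma_N\cong\langle a,b,c \mid a^2=b^2=c^2=1,\ (bc)^N=1\rangle .$$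
   Context: Set $\mu_1=\frac{N-3}{N}\pi$, $\mu_2=\frac{N-1}{N}\pi$, $c_i=\cos\mu_i$, $s_i=\sin\mu_i$, $cc_i=1-c_i$ for $i=1,2$ (here $cc_i$ is a single symbol), and $$r_1=\frac{2(c_1-1)^2}{s_1(c_1-c_2)},\qquad r_2=\frac{2(c_2-1)^2}{s_2(c_2-c_1)},$$ $$L_1=\frac{cc_1\cdot cc_2-3(cc_2-cc_1)}{-cc_1\cdot cc_2+3(cc_1+cc_2)},\qquad L_2=\frac{cc_1\cdot cc_2+3(cc_2-cc_1)}{-cc_1\cdot cc_2+3(cc_1+cc_2)}.$$ Define $$A=\begin{bmatrix}-1&0&0&0\\ -r_1&1&-r_1&0\\ 0&0&-1&0\\ -r_2&0&-r_2&1\end{bmatrix},\quad B=\begin{bmatrix}-1&0&0&0\\ 0&1&0&0\\ 0&0&-1&0\\ 0&0&0&1\end{bmatrix},\quad C=\begin{bmatrix}-c_1&s_1&0&0\\ s_1&c_1&0&0\\ 0&0&-c_2&s_2\\ 0&0&s_2&c_2\end{bmatrix}$$ and $R=BC$. These matrices satisfy $M^tJM=-J$ for $M\in\{A,B,C\}$, where $J$ is the matrix of the symplectic pairing $$J=\begin{bmatrix}0&r_2&0&0\\ -r_2&0&0&0\\ 0&0&0&r_1\\ 0&0&-r_1&0\end{bmatrix}.$$ Let $\tilde\Gamma_N=\langle A,B,C\rangle\subset \mathrm{GSp}_4(\mathbb{R})$ be the group they generate (in the general symplectic group of $J$), and let $P\tilde\Gamma_N$ be its image in $\mathrm{PGSp}_4(\mathbb{R})$,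 i.e. its image acting on $\mathbb{P}(\mathbb{R}^4)$. For vectors $w_0,\ldots,w_3\in\mathbb{R}^4$, $[w_0|w_1|w_2|w_3]$ denotes the closed cone $\{\sum a_iw_i: a_i\geq 0\}$; for a cone $\mathcal{C}\subset\mathbb{R}^4$, $\mathbb{P}\mathcal{C}$ denotes its image in $\mathbb{P}(\mathbb{R}^4)$. Let $\mathcal{C}_0=[v_0|v_1|v_2|v_3]$, where $v_0,v_1,v_2,v_3$ are, in order, the columns of $$\begin{bmatrix}0&-L_2\, cc_1&0&cc_1\\ -L_1\frac{cc_1}{s_1}&-\frac{cc_1^2}{s_1}&-\frac{cc_1}{s_1}&-\frac{cc_1^2}{s_1}\\ 0&L_1\, cc_2&0&-cc_2\\ L_2\frac{cc_2}{s_2}&\frac{cc_2^2}{s_2}&\frac{cc_2}{s_2}&\frac{cc_2^2}{s_2}\end{bmatrix}.$$ Let $\mathcal{C}_0'=B\,\mathcal{C}_0$, and $\mathcal{C}_k=R^k\mathcal{C}_0$, $\mathcal{C}_k'=R^k\mathcal{C}_0'$ for $k=1,\ldots,N-1$. *)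

(* Defs.v *)
From HB Require Import structures.
From mathcomp Require Import all_boot all_order all_algebra.
From mathcomp Require Import all_classical all_reals all_analysis.
From mathcomp Require Import ring.
Import Order.TTheory GRing.Theory Num.Theory.
Import numFieldNormedType.Exports.

Set Implicit Arguments.
Unset Strict Implicit.
Unset Printing Implicit Defensive.

Local Open Scope classical_set_scope.
Local Open Scope ring_scope.

Definition generated (G : groupType) (S : set G) : set G :=
  [set x | forall H : {pred G}, group_closed H ->
             (forall y, S y -> y \in H) -> x \in H].

Lemma generated_closed (G : groupType) (S : set G) :
  group_closed [pred x | `[< generated S x >]].
Proof.
split=> [|x y].
  by apply/asboolP => H [H1 _] _.
move=> /asboolP Sx /asboolP Sy; apply/asboolP => H gH SH.
by apply: gH.2; [exact: Sx|exact: Sy].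
Qed.

(* The letter (x, false) stands for the generator x, and (x, true) for its
   formal inverse. *)
Definition word (T : Type) := seq (T * bool).

Definition letter (T : Type) (x : T) : word T := [:: (x, false)].

Definition word_pow (T : Type) (w : word T) (n : nat) : word T :=
  flatten (nseq n w).

Definition word_inv (T : Type) (w : word T) : word T :=
  rev [seq (l.1, ~~ l.2) | l <- w].

Inductive pres_eqv (T : Type) (rels : set (word T)) :
    word T -> word T -> Prop :=
| pres_refl u : pres_eqv rels u u
| pres_sym u v : pres_eqv rels u v -> pres_eqv rels v u
| pres_trans u v w :
    pres_eqv rels u v -> pres_eqv rels v w -> pres_eqv rels u w
| pres_cat u u' v v' :
    pres_eqv rels u u' -> pres_eqv rels v v' ->
    pres_eqv rels (u ++ v) (u' ++ v')
| pres_cancel x b : pres_eqv rels [:: (x, b); (x, ~~ b)] [::]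
| pres_rel r : rels r -> pres_eqv rels r [::].

Section Presentation.
Context {T : choiceType} (rels : set (word T)).

Definition pres_rel_bool : rel (word T) := fun u v => `[< pres_eqv rels u v >].

Lemma pres_rel_refl : reflexive pres_rel_bool.
Proof. by move=> u; apply/asboolP; exact: pres_refl. Qed.
Lemma pres_rel_sym : symmetric pres_rel_bool.
Proof. by move=> u v; apply/asboolP/asboolP; exact: pres_sym. Qed.
Lemma pres_rel_trans : transitive pres_rel_bool.
Proof.
by move=> v u w /asboolP uv /asboolP vw; apply/asboolP; exact: pres_trans vw.
Qed.

Canonical pres_equiv :=
  EquivRel pres_rel_bool pres_rel_refl pres_rel_sym pres_rel_trans.

Definition presented := {eq_quot pres_equiv}%qT.

HB.instance Definition _ := Choice.on presented.
HB.instance Definition _ := EqQuotient.on presented.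

Lemma pres_piP (u v : word T) :
  (\pi_presented u = \pi_presented v)%qT <-> pres_eqv rels u v.
Proof. by split=> [/eqmodP/asboolP//|uv]; apply/eqmodP/asboolP. Qed.

Lemma pres_repr (u : word T) : pres_eqv rels (repr (\pi_presented u)%qT) u.
Proof. by apply/pres_piP; rewrite reprK. Qed.

Lemma pres_mulV (u : word T) : pres_eqv rels (u ++ word_inv u) [::].
Proof.
elim: u => [|[x b] u IH]; first exact: pres_refl.
have -> : ((x, b) :: u) ++ word_inv ((x, b) :: u) =
    [:: (x, b)] ++ (u ++ word_inv u) ++ [:: (x, ~~ b)].
  by rewrite /word_inv /= rev_cons -cats1 catA.
apply: (pres_trans (v := [:: (x, b)] ++ [::] ++ [:: (x, ~~ b)])); last first.
  exact: pres_cancel.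
apply: pres_cat; first exact: pres_refl.
by apply: pres_cat => //; exact: pres_refl.
Qed.

Lemma word_invK : involutive (@word_inv T).
Proof.
move=> u; rewrite /word_inv map_rev revK -map_comp -[RHS]map_id.
by apply: eq_map => -[x b] /=; rewrite negbK.
Qed.

Lemma pres_Vmul (u : word T) : pres_eqv rels (word_inv u ++ u) [::].
Proof. by rewrite -{2}[u]word_invK; exact: pres_mulV. Qed.

Definition pres_one : presented := (\pi_presented [::])%qT.
Definition pres_mul (x y : presented) : presented :=
  (\pi_presented (repr x ++ repr y))%qT.
Definition pres_inv (x : presented) : presented :=
  (\pi_presented (word_inv (repr x)))%qT.

Lemma pres_mulA : associative pres_mul.
Proof.
move=> x y z; apply/pres_piP.
apply: (pres_trans (v := repr x ++ (repr y ++ repr z))).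
  by apply: pres_cat; [exact: pres_refl|exact: pres_repr].
rewrite catA; apply: pres_cat; last exact: pres_refl.
by apply: pres_sym; exact: pres_repr.
Qed.
Lemma pres_mul1 : left_id pres_one pres_mul.
Proof.
move=> x; rewrite -[RHS]reprK; apply/pres_piP; rewrite -[X in pres_eqv _ _ X]cat0s.
by apply: pres_cat; [exact: pres_repr|exact: pres_refl].
Qed.
Lemma pres_1mul : right_id pres_one pres_mul.
Proof.
move=> x; rewrite -[RHS]reprK; apply/pres_piP; rewrite -[X in pres_eqv _ _ X]cats0.
by apply: pres_cat; [exact: pres_refl|exact: pres_repr].
Qed.
Lemma pres_mulVx : left_inverse pres_one pres_inv pres_mul.
Proof.
move=> x; apply/pres_piP; apply: pres_trans (pres_Vmul (repr x)).
by apply: pres_cat; [exact: pres_repr|exact: pres_refl].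
Qed.
Lemma pres_mulxV : right_inverse pres_one pres_inv pres_mul.
Proof.
move=> x; apply/pres_piP; apply: pres_trans (pres_mulV (repr x)).
by apply: pres_cat; [exact: pres_refl|exact: pres_repr].
Qed.

HB.instance Definition _ :=
  isGroup.Build presented pres_mulA pres_mul1 pres_1mul pres_mulVx pres_mulxV.

End Presentation.

Section GSp.
Context {R : fieldType} {n : nat} (J : 'M[R]_n).

Definition is_gsp (M : 'M[R]_n) : bool :=
  (M \in unitmx) && `[< exists2 l : R, l != 0 & M^T *m J *m M = l *: J >].

Record gsp := Gsp { gsp_val :> 'M[R]_n ; gsp_valP : is_gsp gsp_val }.

HB.instance Definition _ := [isSub for gsp_val].
HB.instance Definition _ := [Choice of gsp by <:].

Lemma gsp_unit (g : gsp) : gsp_val g \in unitmx.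
Proof. by case: g => M /= /andP[]. Qed.

Lemma is_gsp1 : is_gsp 1%:M.
Proof.
rewrite /is_gsp unitmx1; apply/asboolP; exists 1; first exact: oner_neq0.
by rewrite trmx1 mul1mx mulmx1 scale1r.
Qed.

Lemma is_gspM (g h : gsp) : is_gsp (g *m h).
Proof.
case: g h => [M /= /andP[uM /asboolP[l l0 JM]]] [P /= /andP[uP /asboolP[m m0 JP]]].
rewrite /is_gsp unitmx_mul uM uP; apply/asboolP; exists (l * m).
  by rewrite mulf_neq0.
by rewrite trmx_mul -!mulmxA (mulmxA J) (mulmxA M^T) (mulmxA M^T) JM
     -scalemxAl -scalemxAr mulmxA JP scalerA.
Qed.

Lemma is_gspV (g : gsp) : is_gsp (invmx g).
Proof.
case: g => [M /= /andP[uM /asboolP[l l0 JM]]].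
rewrite /is_gsp unitmx_inv uM; apply/asboolP; exists l^-1.
  by rewrite invr_neq0.
apply: (scalerI l0); rewrite scalerA mulfV// scale1r.
rewrite scalemxAl scalemxAr -JM !mulmxA -trmx_mul mulmxV// trmx1 mul1mx.
by rewrite -mulmxA mulmxV// mulmx1.
Qed.

Definition gsp_one : gsp := Gsp is_gsp1.
Definition gsp_mul (g h : gsp) : gsp := Gsp (is_gspM g h).
Definition gsp_inv (g : gsp) : gsp := Gsp (is_gspV g).

Lemma gsp_mulA : associative gsp_mul.
Proof. by move=> f g h; apply: val_inj; rewrite /= mulmxA. Qed.
Lemma gsp_mul1 : left_id gsp_one gsp_mul.
Proof. by move=> g; apply: val_inj; rewrite /= mul1mx. Qed.
Lemma gsp_1mul : right_id gsp_one gsp_mul.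
Proof. by move=> g; apply: val_inj; rewrite /= mulmx1. Qed.
Lemma gsp_mulVx : left_inverse gsp_one gsp_inv gsp_mul.
Proof. by move=> g; apply: val_inj; rewrite /= mulVmx// gsp_unit. Qed.
Lemma gsp_mulxV : right_inverse gsp_one gsp_inv gsp_mul.
Proof. by move=> g; apply: val_inj; rewrite /= mulmxV// gsp_unit. Qed.

HB.instance Definition _ :=
  isGroup.Build gsp gsp_mulA gsp_mul1 gsp_1mul gsp_mulVx gsp_mulxV.

Definition pgsp_rel : rel gsp :=
  fun g h => `[< exists2 l : R, l != 0 & gsp_val h = l *: gsp_val g >].

Lemma pgsp_rel_refl : reflexive pgsp_rel.
Proof.
by move=> g; apply/asboolP; exists 1; rewrite ?oner_neq0 ?scale1r.
Qed.
Lemma pgsp_rel_sym : symmetric pgsp_rel.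
Proof.
by move=> g h; apply/asboolP/asboolP => -[l l0 E]; exists l^-1;
  rewrite ?invr_neq0// E scalerA mulVf// scale1r.
Qed.
Lemma pgsp_rel_trans : transitive pgsp_rel.
Proof.
move=> h g k /asboolP[l l0 E] /asboolP[m m0 F]; apply/asboolP.
by exists (m * l); rewrite ?mulf_neq0// F E scalerA.
Qed.

Canonical pgsp_equiv :=
  EquivRel pgsp_rel pgsp_rel_refl pgsp_rel_sym pgsp_rel_trans.

Definition pgsp := {eq_quot pgsp_equiv}%qT.

HB.instance Definition _ := Choice.on pgsp.
HB.instance Definition _ := EqQuotient.on pgsp.

Lemma pgsp_piP (g h : gsp) :
  (\pi_pgsp g = \pi_pgsp h)%qT <->
  exists2 l : R, l != 0 & gsp_val h = l *: gsp_val g.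
Proof. by split=> [/eqmodP/asboolP//|gh]; apply/eqmodP/asboolP. Qed.

Definition pgsp_one : pgsp := (\pi_pgsp 1%g)%qT.
Definition pgsp_mul (x y : pgsp) : pgsp := (\pi_pgsp (repr x * repr y)%g)%qT.
Definition pgsp_inv (x : pgsp) : pgsp := (\pi_pgsp (repr x)^-1%g)%qT.

Lemma pgsp_piM (g h : gsp) :
  (\pi_pgsp (g * h)%g = pgsp_mul (\pi_pgsp g) (\pi_pgsp h))%qT.
Proof.
apply/pgsp_piP => /=.
have [l l0 ->] : exists2 l : R, l != 0 &
    gsp_val (repr (\pi_pgsp g)%qT) = l *: gsp_val g.
  by apply/pgsp_piP; rewrite reprK.
have [m m0 ->] : exists2 l : R, l != 0 &
    gsp_val (repr (\pi_pgsp h)%qT) = l *: gsp_val h.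
  by apply/pgsp_piP; rewrite reprK.
exists (l * m); first by rewrite mulf_neq0.
by rewrite -scalemxAl -scalemxAr scalerA.
Qed.

Lemma pgsp_mulA : associative pgsp_mul.
Proof.
elim/quotW=> f; elim/quotW=> g; elim/quotW=> h.
by rewrite -(pgsp_piM g h) -(pgsp_piM f g) -(pgsp_piM f (g * h)%g)
     -(pgsp_piM (f * g)%g h) mulgA.
Qed.
Lemma pgsp_mul1 : left_id pgsp_one pgsp_mul.
Proof. by elim/quotW=> g; rewrite -(pgsp_piM 1%g g) mul1g. Qed.
Lemma pgsp_1mul : right_id pgsp_one pgsp_mul.
Proof. by elim/quotW=> g; rewrite -(pgsp_piM g 1%g) mulg1. Qed.
Lemma pgsp_mulVx : left_inverse pgsp_one pgsp_inv pgsp_mul.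
Proof.
move=> x; rewrite -[in X in pgsp_mul _ X](reprK x).
by rewrite -(pgsp_piM (repr x)^-1%g (repr x)) mulVg.
Qed.
Lemma pgsp_mulxV : right_inverse pgsp_one pgsp_inv pgsp_mul.
Proof.
move=> x; rewrite -[in X in pgsp_mul X _](reprK x).
by rewrite -(pgsp_piM (repr x) (repr x)^-1%g) mulgV.
Qed.

HB.instance Definition _ :=
  isGroup.Build pgsp pgsp_mulA pgsp_mul1 pgsp_1mul pgsp_mulVx pgsp_mulxV.

End GSp.

Section Projective.
Context {R : realType} {n : nat}.

Definition nzvec := set_type [set v : 'cV[R]_n | v != 0].
HB.instance Definition _ := Topological.on nzvec.

Definition proj_rel : rel nzvec :=
  fun v w => `[< exists2 l : R, l != 0 & \val w = l *: \val v >].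

Lemma proj_rel_refl : reflexive proj_rel.
Proof.
by move=> v; apply/asboolP; exists 1; rewrite ?oner_neq0 ?scale1r.
Qed.
Lemma proj_rel_sym : symmetric proj_rel.
Proof.
by move=> v w; apply/asboolP/asboolP => -[l l0 E]; exists l^-1;
  rewrite ?invr_neq0// E scalerA mulVf// scale1r.
Qed.
Lemma proj_rel_trans : transitive proj_rel.
Proof.
move=> w v u /asboolP[l l0 E] /asboolP[m m0 F]; apply/asboolP.
by exists (m * l); rewrite ?mulf_neq0// F E scalerA.
Qed.

Canonical proj_equiv :=
  EquivRel proj_rel proj_rel_refl proj_rel_sym proj_rel_trans.

(* The library's quotient topology, on top of the subspace topology of
   R^n \ {0}. *)
Definition proj := quotient_topology {eq_quot proj_equiv}%qT.

HB.instance Definition _ := Topological.on proj.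
HB.instance Definition _ := Quotient.on proj.

Definition proj_img (C : set 'cV[R]_n) : set proj :=
  [set \pi_proj v | v in [set v : nzvec | C (\val v)]]%qT.

Lemma nzvec_act_subproof (J : 'M[R]_n) (g : gsp J) (v : nzvec) :
  gsp_val g *m \val v \in [set v : 'cV[R]_n | v != 0].
Proof.
apply/mem_set => /=; apply/negP => /eqP E.
have /set_mem /= := valP v; rewrite -[\val v]mul1mx -(mulVmx (gsp_unit g)).
by rewrite -mulmxA E mulmx0 eqxx.
Qed.

Definition nzvec_act (J : 'M[R]_n) (g : gsp J) (v : nzvec) : nzvec :=
  exist _ (gsp_val g *m \val v) (nzvec_act_subproof g v).

Definition proj_act (J : 'M[R]_n) (g : gsp J) (x : proj) : proj :=
  (\pi_proj (nzvec_act g (repr x)))%qT.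

Lemma proj_piP (v w : nzvec) :
  (\pi_proj v = \pi_proj w)%qT <->
  exists2 l : R, l != 0 & \val w = l *: \val v.
Proof.
by split=> [/(@eqmodP _ proj_equiv)/asboolP//|vw];
  apply/(@eqmodP _ proj_equiv)/asboolP.
Qed.

Lemma proj_actE (J : 'M[R]_n) (g : gsp J) (v : nzvec) :
  (proj_act g (\pi_proj v) = \pi_proj (nzvec_act g v))%qT.
Proof.
apply/proj_piP.
have /proj_piP[l l0 E] : (\pi_proj (repr (\pi_proj v)) = \pi_proj v)%qT.
  by rewrite reprK.
by exists l => //=; rewrite E scalemxAr.
Qed.

End Projective.
Arguments nzvec : clear implicits.
Arguments proj : clear implicits.

Definition cone {R : realType} (n : nat) (w : 'I_n -> 'cV[R]_n) :
    set 'cV[R]_n :=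
  [set v | exists2 a : 'I_n -> R, (forall i, 0 <= a i) &
             v = \sum_i a i *: w i].

Definition mx4 {R : realType} (rows : seq (seq R)) : 'M[R]_4 :=
  \matrix_(i, j) nth 0 (nth [::] rows i) j.

Section Data.
Context (R : realType) (N : nat).

Definition mu1 : R := (N%:R - 3) / N%:R * pi.
Definition mu2 : R := (N%:R - 1) / N%:R * pi.
Definition c1 : R := cos mu1.
Definition c2 : R := cos mu2.
Definition s1 : R := sin mu1.
Definition s2 : R := sin mu2.
Definition cc1 : R := 1 - c1.
Definition cc2 : R := 1 - c2.
Definition r1 : R := 2 * (c1 - 1) ^+ 2 / (s1 * (c1 - c2)).
Definition r2 : R := 2 * (c2 - 1) ^+ 2 / (s2 * (c2 - c1)).
Definition L1 : R :=
  (cc1 * cc2 - 3 * (cc2 - cc1)) / (- (cc1 * cc2) + 3 * (cc1 + cc2)).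
Definition L2 : R :=
  (cc1 * cc2 + 3 * (cc2 - cc1)) / (- (cc1 * cc2) + 3 * (cc1 + cc2)).

Definition matA : 'M[R]_4 := mx4
  [:: [:: -1;   0;   0;   0];
      [:: -r1;  1;   -r1; 0];
      [:: 0;    0;   -1;  0];
      [:: -r2;  0;   -r2; 1]].

Definition matB : 'M[R]_4 := mx4
  [:: [:: -1;  0;  0;  0];
      [:: 0;   1;  0;  0];
      [:: 0;   0;  -1; 0];
      [:: 0;   0;  0;  1]].

Definition matC : 'M[R]_4 := mx4
  [:: [:: -c1; s1; 0;   0];
      [:: s1;  c1; 0;   0];
      [:: 0;   0;  -c2; s2];
      [:: 0;   0;  s2;  c2]].

Definition matR : 'M[R]_4 := matB *m matC.

Definition matJ : 'M[R]_4 := mx4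
  [:: [:: 0;   r2; 0;   0];
      [:: -r2; 0;  0;   0];
      [:: 0;   0;  0;   r1];
      [:: 0;   0;  -r1; 0]].

Lemma matA_sympl : matA^T *m matJ *m matA = - matJ.
Proof.
apply/matrixP => i j; rewrite !mxE !big_ord_recl big_ord0 !mxE.
rewrite !big_ord_recl !big_ord0 !mxE.
by case: i => [[|[|[|[|//]]]] ?]; case: j => [[|[|[|[|//]]]] ?] /=; ring.
Qed.

Lemma matB_sympl : matB^T *m matJ *m matB = - matJ.
Proof.
apply/matrixP => i j; rewrite !mxE !big_ord_recl big_ord0 !mxE.
rewrite !big_ord_recl !big_ord0 !mxE.
by case: i => [[|[|[|[|//]]]] ?]; case: j => [[|[|[|[|//]]]] ?] /=; ring.
Qed.

Lemma matC_sympl : matC^T *m matJ *m matC = - matJ.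
Proof.
have s1E : s1 ^+ 2 = 1 - c1 ^+ 2 by rewrite /s1 sin2cos2.
have s2E : s2 ^+ 2 = 1 - c2 ^+ 2 by rewrite /s2 sin2cos2.
apply/matrixP => i j; rewrite !mxE !big_ord_recl big_ord0 !mxE.
rewrite !big_ord_recl !big_ord0 !mxE.
by case: i => [[|[|[|[|//]]]] ?]; case: j => [[|[|[|[|//]]]] ?] /=;
  ring: s1E s2E.
Qed.

Lemma matA_sq : matA *m matA = 1%:M.
Proof.
apply/matrixP => i j; rewrite !mxE !big_ord_recl big_ord0 !mxE.
by case: i => [[|[|[|[|//]]]] ?]; case: j => [[|[|[|[|//]]]] ?] /=; ring.
Qed.

Lemma matB_sq : matB *m matB = 1%:M.
Proof.
apply/matrixP => i j; rewrite !mxE !big_ord_recl big_ord0 !mxE.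
by case: i => [[|[|[|[|//]]]] ?]; case: j => [[|[|[|[|//]]]] ?] /=; ring.
Qed.

Lemma matC_sq : matC *m matC = 1%:M.
Proof.
have s1E : s1 ^+ 2 = 1 - c1 ^+ 2 by rewrite /s1 sin2cos2.
have s2E : s2 ^+ 2 = 1 - c2 ^+ 2 by rewrite /s2 sin2cos2.
apply/matrixP => i j; rewrite !mxE !big_ord_recl big_ord0 !mxE.
by case: i => [[|[|[|[|//]]]] ?]; case: j => [[|[|[|[|//]]]] ?] /=;
  ring: s1E s2E.
Qed.

Lemma is_gsp_antisympl (M : 'M[R]_4) :
  M *m M = 1%:M -> M^T *m matJ *m M = - matJ -> is_gsp matJ M.
Proof.
move=> M2 MJ; rewrite /is_gsp; apply/andP; split.
  by case: (mulmx1_unit M2).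
by apply/asboolP; exists (-1); rewrite ?oppr_eq0 ?oner_neq0// scaleN1r.
Qed.

Definition gspA : gsp matJ := Gsp (is_gsp_antisympl matA_sq matA_sympl).
Definition gspB : gsp matJ := Gsp (is_gsp_antisympl matB_sq matB_sympl).
Definition gspC : gsp matJ := Gsp (is_gsp_antisympl matC_sq matC_sympl).

Definition Gamma : set (gsp matJ) := generated [set gspA; gspB; gspC].

Definition is_PGamma : {pred pgsp matJ} :=
  [pred x | `[< exists2 g, Gamma g & x = (\pi_(pgsp matJ) g)%qT >]].

Lemma is_PGamma_closed : group_closed is_PGamma.
Proof.
have [G1 GF] := generated_closed [set gspA; gspB; gspC].
split=> [|x y].
  by apply/asboolP; exists 1%g => //; exact/asboolP.
move=> /asboolP[g Gg ->] /asboolP[h Gh ->]; apply/asboolP.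
exists (g / h)%g; first by apply/asboolP; apply: GF; exact/asboolP.
rewrite pgsp_piM; congr pgsp_mul.
apply: (@mulgI (pgsp matJ) (\pi_(pgsp matJ) h)%qT); rewrite mulgV.
by rewrite [RHS](esym (pgsp_piM _ _)) mulgV.
Qed.

Definition PGamma := {x : pgsp matJ | is_PGamma x}.
HB.instance Definition _ := SubChoice.on PGamma.
HB.instance Definition _ :=
  SubChoice_isSubGroup.Build _ is_PGamma PGamma is_PGamma_closed.

Definition matV : 'M[R]_4 := mx4
  [:: [:: 0; - (L2 * cc1); 0; cc1];
      [:: - (L1 * (cc1 / s1)); - (cc1 ^+ 2 / s1); - (cc1 / s1); - (cc1 ^+ 2 / s1)];
      [:: 0; L1 * cc2; 0; - cc2];
      [:: L2 * (cc2 / s2); cc2 ^+ 2 / s2; cc2 / s2; cc2 ^+ 2 / s2]].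

(* With C_0 the cone on the columns of matV, simplicial_cone false k is R^k C_0
   and simplicial_cone true k is R^k B C_0. *)
Definition simplicial_cone (primed : bool) (k : nat) : set 'cV[R]_4 :=
  let C0 := cone (fun i => col i matV) in
  [set matR ^+ k *m v |
    v in if primed then [set matB *m v | v in C0] else C0].

Definition proj_cone (primed : bool) (k : nat) : set (proj R 4) :=
  proj_img (simplicial_cone primed k).

End Data.
Arguments matA : clear implicits.
Arguments matB : clear implicits.
Arguments matC : clear implicits.
Arguments matR : clear implicits.
Arguments matV : clear implicits.
Arguments simplicial_cone : clear implicits.
Arguments proj_cone : clear implicits.

(* The relators of < a, b, c | a^2 = b^2 = c^2 = (bc)^N = 1 >, where the
   generators a, b, c are 0, 1, 2 : 'I_3. *)
Definition coxeter_rels (N : nat) : set (word 'I_3) :=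
  let a := letter (0 : 'I_3) in
  let b := letter (1 : 'I_3) in
  let c := letter (2 : 'I_3) in
  [set word_pow a 2; word_pow b 2; word_pow c 2; word_pow (b ++ c) N].

(* Main.v *)
Require Import Defs.
From HB Require Import structures.
From mathcomp Require Import all_boot all_order all_algebra.
From mathcomp Require Import all_classical all_reals all_analysis.
From mathcomp Require Import ring lra zify.
Import Order.TTheory GRing.Theory Num.Theory.
Import numFieldNormedType.Exports.
Set Implicit Arguments.
Unset Strict Implicit.
Unset Printing Implicit Defensive.

Local Open Scope classical_set_scope.
Local Open Scope ring_scope.

(** Put t = pi / N. As mu1 = pi - 3 t and mu2 = pi - t, the matrix - R acts on
R^4 = C (+) C, with coordinates z1 = x1 + i y1 and z2 = x2 + i y2, by
(z1, z2) |-> (e^(-3it) z1, e^(-it) z2), so R^N is a sign; and B conjugates R to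
its inverse. Up to sign, B and C thus generate a dihedral group D of order 2N,
and the 2N cones are its translates d C0 (dihmx lists the elements of D).

Disjointness. The quadratic map phi(z) = r z1 conj(z2) + z2^2, with r real,
satisfies phi (R z) = e^(-2it) phi z and phi (B z) = conj (phi z). For
r = -3 (2 cos t - 1) it sends C0 into a closed sector of angle t, between the
mirrors of B and C; this amounts to 20 sign conditions on pairs of generators
of C0 (phi_im_cone, phi_wall_cone). The 2N translates of that sector under D
tile the plane, hence at a point common to d C0 and to another cone one of two
quadratic forms vanishes (cone_overlap). A product of two nonzero quadratic
forms has no open set of zeros (quadratic_prod_neq0), so the interiors of two
cones are disjoint.

Attraction. If V has the generators v0, v1, v2, v3 of C0 as columns, then
V W = (L2 - L1) A for an explicit matrix W with L1 < L2, so A maps a vector x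
into C0 as soon as W x is nonnegative. For x = d v_j the entries of W x are
trigonometric polynomials of degree 3 in the rotation angle k t of d. Relations
such as v3 = v2 + (- R)^-1 v2, together with the reflection of the angle,
reduce the 32 entries to seven functions, whose signs at the angles k t are
the content of the lemmas row1_v0_ge0 to row2_Bv1_ge0.

Presentation. In the abstract group every element is a product
d0 a d1 a ... a dn with d_i in the dihedral group and d1, ..., d(n-1)
nontrivial (has_nf_presented). If n > 0 and such a product were scalar, choose
e in D different from d0 and from the inverse of dn; pushing e C0 through the
product, each letter a sends a cone other than C0 into C0, so e C0 would lie in
d0 C0, against the disjointness (nfmx_scalar). The obvious morphism from the
presented group onto the projective group is therefore injective. *)

(** * Vectors of length four *)

Section Vec4.
Variable R : realType.

Definition vec4 (a b c d : R) : 'cV[R]_4 := \col_i nth 0 [:: a; b; c; d] i.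

Lemma vec4_eta (v : 'cV[R]_4) : exists a b c d, v = vec4 a b c d.
Proof.
exists (v 0 0), (v 1 0), (v 2 0), (v 3 0).
apply/matrixP => i j; rewrite (ord1 j) mxE.
by case: i => [[|[|[|[|//]]]] ?] /=; congr (v _ _); apply: val_inj.
Qed.

Lemma mx4_vec4 (a0 a1 a2 a3 b0 b1 b2 b3 c0 c1 c2 c3 d0 d1 d2 d3 : R) w x y z :
  mx4 [:: [:: a0; a1; a2; a3]; [:: b0; b1; b2; b3];
          [:: c0; c1; c2; c3]; [:: d0; d1; d2; d3]] *m vec4 w x y z =
  vec4 (a0 * w + a1 * x + a2 * y + a3 * z) (b0 * w + b1 * x + b2 * y + b3 * z)
       (c0 * w + c1 * x + c2 * y + c3 * z) (d0 * w + d1 * x + d2 * y + d3 * z).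
Proof.
apply/matrixP => i j; rewrite !mxE !big_ord_recl big_ord0 !mxE.
by case: i => [[|[|[|[|//]]]] ?] /=; rewrite addr0 !addrA.
Qed.

Lemma scale_vec4 k (a b c d : R) :
  k *: vec4 a b c d = vec4 (k * a) (k * b) (k * c) (k * d).
Proof.
by apply/matrixP => i j; rewrite !mxE; case: i => [[|[|[|[|//]]]] ?].
Qed.

Lemma eq_mx_vec4 (M M' : 'M[R]_4) :
  (forall a b c d, M *m vec4 a b c d = M' *m vec4 a b c d) -> M = M'.
Proof.
move=> E; apply/trmx_inj/row_matrixP => i; rewrite -!tr_col; congr _^T.
rewrite !colE.
by have [a [b [c [d ->]]]] := vec4_eta (delta_mx i 0).
Qed.

End Vec4.

(** * The matrix R as a rotation *)

Section Rot.
Variables (R : realType) (N : nat).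
Hypothesis hN : (4 <= N)%N.

Let t : R := pi / N%:R.

Lemma Nt : N%:R * t = pi.
Proof. by rewrite /t mulrCA mulfV ?mulr1 // pnatr_eq0; case: N hN. Qed.

Lemma mu1E : mu1 R N = pi - 3 * t.
Proof.
rewrite -[in RHS]Nt /mu1 /t; field.
by rewrite pnatr_eq0; case: N hN.
Qed.

Lemma mu2E : mu2 R N = pi - t.
Proof.
rewrite -[in RHS]Nt /mu2 /t; field.
by rewrite pnatr_eq0; case: N hN.
Qed.

Lemma c1E : c1 R N = - cos (3 * t).
Proof. by rewrite /c1 mu1E cosB cospi sinpi mul0r addr0 mulN1r. Qed.
Lemma s1E : s1 R N = sin (3 * t).
Proof. by rewrite /s1 mu1E sinB cospi sinpi mul0r sub0r mulN1r opprK. Qed.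
Lemma c2E : c2 R N = - cos t.
Proof. by rewrite /c2 mu2E cosB cospi sinpi mul0r addr0 mulN1r. Qed.
Lemma s2E : s2 R N = sin t.
Proof. by rewrite /s2 mu2E sinB cospi sinpi mul0r sub0r mulN1r opprK. Qed.

(** The sense of rotation is that of - R, which is rotmx (pi / N): multiplication by
e^(-3ix) on the first plane and by e^(-ix) on the second. *)
Definition rotmx (x : R) : 'M[R]_4 := mx4
  [:: [:: cos (3 * x);   sin (3 * x); 0;         0];
      [:: - sin (3 * x); cos (3 * x); 0;         0];
      [:: 0;             0;           cos x;     sin x];
      [:: 0;             0;           - sin x;   cos x]].

Lemma rotmxD x y : rotmx (x + y) = rotmx x *m rotmx y.
Proof.
apply: eq_mx_vec4 => a b c d; rewrite -mulmxA !mx4_vec4.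
by rewrite mulrDr !(cosD, sinD); congr vec4; ring.
Qed.

Lemma rotmx0 : rotmx 0 = 1%:M.
Proof.
apply: eq_mx_vec4 => a b c d; rewrite mx4_vec4 mul1mx mulr0 cos0 sin0.
by congr vec4; ring.
Qed.

Lemma matB_rotmx x : matB R *m rotmx x = rotmx (- x) *m matB R.
Proof.
apply: eq_mx_vec4 => a b c d; rewrite -!mulmxA !mx4_vec4 mulrN !(cosN, sinN).
by congr vec4; ring.
Qed.

Lemma matRE : matR R N = - rotmx t.
Proof.
apply: eq_mx_vec4 => a b c d; rewrite mulNmx -scaleN1r -!mulmxA !mx4_vec4.
by rewrite scale_vec4 c1E c2E s1E s2E; congr vec4; ring.
Qed.

Lemma matR_exp k : matR R N ^+ k = (-1) ^+ k *: rotmx (k%:R * t).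
Proof.
elim: k => [|k IH]; first by rewrite !expr0 mul0r rotmx0 scale1r.
rewrite exprS IH matRE -natr1 mulrDl mul1r addrC rotmxD.
rewrite -mulmxE mulNmx -scalemxAr -scaleN1r scalerA.
by rewrite exprS.
Qed.

Lemma rotmx_pi : rotmx pi = - 1%:M.
Proof.
apply: eq_mx_vec4 => a b c d; rewrite mx4_vec4 mulNmx mul1mx -[- vec4 _ _ _ _]scaleN1r scale_vec4.
have -> : 3 * pi = pi + pi *+ 2 :> R by rewrite -mulr_natl; ring.
by rewrite cosD2pi sinD2pi cospi sinpi; congr vec4; ring.
Qed.

End Rot.

(** * Trigonometry of the angles k t *)

Section Trig.
Variables (R : realType) (N : nat).
Hypothesis hN : (4 <= N)%N.

Local Notation t := (pi / N%:R : R).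
Local Notation u := (cos t).
Local Notation s := (sin t).

Lemma angle_ge0 k : 0 <= k%:R * t.
Proof. by rewrite mulr_ge0 ?divr_ge0 ?pi_ge0. Qed.

Lemma angle_le k m : (k <= m)%N -> k%:R * t <= m%:R * t.
Proof. by move=> km; rewrite ler_wpM2r ?ler_nat// divr_ge0 ?pi_ge0. Qed.

Lemma sin_angle_ge0 k : (k <= N)%N -> 0 <= sin (k%:R * t).
Proof.
move=> kN; apply: sin_ge0_pi; rewrite angle_ge0 /=.
by rewrite -[leRHS](Nt R hN) angle_le.
Qed.

(** The sine is antiperiodic with antiperiod N t = pi. *)
Lemma sin_angle_le0 k : (N <= k <= 2 * N)%N -> sin (k%:R * t) <= 0.
Proof.
case/andP=> Nk kN; have := @sin_angle_ge0 (k - N)%N.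
rewrite leq_subLR addnn -mul2n => /(_ kN).
by rewrite natrB// mulrBl Nt// sinB cospi sinpi mulr0 subr0 mulrN1 oppr_ge0.
Qed.

Lemma s_gt0 : 0 < s.
Proof.
have t0 : 0 < t by rewrite divr_gt0 ?pi_gt0 ?ltr0n//; case: N hN.
apply: sin_gt0_pi; rewrite t0 -[ltRHS](Nt R hN) -[ltLHS]mul1r ltr_pM2r//.
by rewrite ltr1n (leq_trans _ hN).
Qed.

Lemma sin_sq : s ^+ 2 = 1 - u ^+ 2.
Proof. exact: sin2cos2. Qed.

(** N >= 4 gives 2 t <= pi / 2, hence 0 <= cos (2 t) = 2 cos(t)^2 - 1. *)
Lemma u_bounds : 0 < u /\ 1 <= 2 * u ^+ 2.
Proof.
have t0 : 0 <= t by rewrite divr_ge0 ?pi_ge0.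
have t4 : 2 * t <= pi / 2.
  have : 4%:R * t <= pi by rewrite -[leRHS](Nt R hN) angle_le.
  by move=> ?; lra.
have pi0 := pi_gt0 R.
split; first by apply: cos_gt0_pihalf; lra.
have : 0 <= cos (t *+ 2) by apply: cos_ge0_pihalf; rewrite -mulr_natl; lra.
by rewrite cos_mulr2n -mulr_natl; lra.
Qed.

Lemma u_lt1 : u < 1.
Proof.
have := s_gt0; have := sin_sq; have := cos_le1 t; rewrite le_eqVlt.
by case/orP => // /eqP ->; nra.
Qed.

Lemma u_ge : 7 <= 10 * u.
Proof. by have [u0 u2] := u_bounds; nra. Qed.

Lemma cos3E (x : R) : cos (3 * x) = cos x * (1 - 4 * sin x ^+ 2).
Proof.
have -> : 3 * x = x + x + x by ring.
by rewrite !(cosD, sinD); ring: (sin2cos2 x).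
Qed.

Lemma sin3E (x : R) : sin (3 * x) = sin x * (3 - 4 * sin x ^+ 2).
Proof.
have -> : 3 * x = x + x + x by ring.
by rewrite !(cosD, sinD); ring: (cos2sin2 x).
Qed.

End Trig.

(** * Polynomial inequalities in cos t *)

(** The interval [7/10, 1[ contains cos t because cos t >= cos (pi/4) > 7/10. The
products below, for i + j = n, are up to scale the Bernstein polynomials of
degree n on it. *)
Lemma bern_ge0 (R : realFieldType) (i j : nat) (x : R) :
  7 <= 10 * x -> x < 1 -> 0 <= (10 * x - 7) ^+ i * (1 - x) ^+ j.
Proof. by move=> x7 /ltW x1; rewrite mulr_ge0// exprn_ge0// subr_ge0. Qed.

(** Proves that a polynomial of degree at most n in x is nonnegative by writing it
as a nonnegative combination of the Bernstein polynomials of degree n; finding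
the coefficients is a linear problem. *)
Ltac bernstein n h7 h1 :=
  let rec go i j :=
    pose proof (bern_ge0 i j h7 h1);
    lazymatch j with
    | 0%N => idtac
    | S ?j' => go (S i) j'
    end in
  go 0%N n; lra.

(** * The constants as rational functions of cos t and sin t *)

Section Data.
Variables (R : realType) (N : nat).
Hypothesis hN : (4 <= N)%N.

Local Notation t := (pi / N%:R : R).
Local Notation u := (cos t).
Local Notation s := (sin t).
Local Notation L1 := (L1 R N).
Local Notation L2 := (L2 R N).
Local Notation cc1 := (cc1 R N).
Local Notation cc2 := (cc2 R N).
Local Notation s1 := (s1 R N).
Local Notation s2 := (s2 R N).

Lemma cc2u : cc2 = 1 + u.
Proof. by rewrite /Defs.cc2 c2E// opprK. Qed.

Lemma cc1u : cc1 = (1 + u) * (2 * u - 1) ^+ 2.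
Proof. by rewrite /Defs.cc1 c1E// cos3E sin_sq; ring. Qed.

Lemma s1u : s1 = s * (4 * u ^+ 2 - 1).
Proof. by rewrite s1E// sin3E sin_sq; ring. Qed.

(** The common denominator of L1 and L2, after cancelling the factor 1 + cos t. *)
Definition denL : R := 5 - 9 * u + 12 * u ^+ 2 - 4 * u ^+ 3.

Lemma denL_gt : 32 / 10 < denL.
Proof.
have := u_ge R hN; have := u_lt1 R hN; rewrite /denL.
by move=> h1 h7; bernstein 3%N h7 h1.
Qed.

Lemma denL_neq0 : denL != 0.
Proof. by rewrite gt_eqF// (lt_trans _ denL_gt). Qed.

Lemma L_denominator : - (cc1 * cc2) + 3 * (cc1 + cc2) = (1 + u) * denL.
Proof. by rewrite cc1u cc2u /denL; ring. Qed.

Lemma u1_neq0 : 1 + u != 0.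
Proof. by have [u0 _] := u_bounds R hN; rewrite gt_eqF//; lra. Qed.

Lemma L1_denL : L1 * denL = 1 - 15 * u + 12 * u ^+ 2 + 4 * u ^+ 3.
Proof.
rewrite /Defs.L1 L_denominator cc1u cc2u; have := u1_neq0; have := denL_neq0.
by move=> *; field; apply/andP.
Qed.

Lemma L2_denL : L2 * denL = 1 + 9 * u - 12 * u ^+ 2 + 4 * u ^+ 3.
Proof.
rewrite /Defs.L2 L_denominator cc1u cc2u; have := u1_neq0; have := denL_neq0.
by move=> *; field; apply/andP.
Qed.

Lemma s1_gt0 : 0 < s1.
Proof.
rewrite s1u mulr_gt0 ?s_gt0//.
by have [u0 u2] := u_bounds R hN; lra.
Qed.

Lemma cc1_gt0 : 0 < cc1.
Proof.
have := u_ge R hN => u7; rewrite cc1u mulr_gt0 ?exprn_gt0//; lra.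
Qed.

Lemma cc2_gt0 : 0 < cc2.
Proof. by rewrite cc2u; have := u_ge R hN; lra. Qed.

Lemma L_lt : 0 < L2 - L1.
Proof.
rewrite -(pmulr_lgt0 _ (lt_trans _ denL_gt))// mulrBl L1_denL L2_denL.
by have h7 := u_ge R hN; have h1 := u_lt1 R hN; bernstein 3%N h7 h1.
Qed.

Lemma L_sum_ge0 : 0 <= L1 + L2.
Proof.
rewrite -(pmulr_lge0 _ (lt_trans _ denL_gt))// mulrDl L1_denL L2_denL.
by have h7 := u_ge R hN; have h1 := u_lt1 R hN; bernstein 3%N h7 h1.
Qed.

(** As 1 - cos x = sin x * tan (x / 2) and mu1 = pi - 3 t, this is the cotangent of
3 t / 2; likewise cot2 is the cotangent of t / 2. *)
Definition cot1 : R := cc1 / s1.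
Definition cot2 : R := cc2 / s2.

End Data.

(** * The matrix A in the basis of the generators of C0 *)

Section Entries.
Variables (R : realType) (N : nat).
Hypothesis hN : (4 <= N)%N.

Local Notation t := (pi / N%:R : R).
Local Notation L1 := (L1 R N).
Local Notation L2 := (L2 R N).
Local Notation cot1 := (cot1 R N).
Local Notation cot2 := (cot2 R N).

Lemma cot1_gt0 : 0 < cot1.
Proof. by rewrite divr_gt0 ?s1_gt0 ?cc1_gt0. Qed.
Lemma cot2_gt0 : 0 < cot2.
Proof. by rewrite divr_gt0 ?cc2_gt0// s2E// s_gt0. Qed.

Lemma cot1sq_neq0 : 1 + cot1 ^+ 2 != 0.
Proof. by rewrite gt_eqF// ltr_pwDl// sqr_ge0. Qed.
Lemma cot2sq_neq0 : 1 + cot2 ^+ 2 != 0.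
Proof. by rewrite gt_eqF// ltr_pwDl// sqr_ge0. Qed.

(** The half-angle substitution: written in k, an identity between trigonometric
constants becomes one between rational functions, with no relation left to use. *)
Lemma half_angle (c s : R) : s ^+ 2 = 1 - c ^+ 2 -> s != 0 ->
  let k := (1 - c) / s in
  [/\ 1 - c = 2 * k ^+ 2 / (1 + k ^+ 2), s = 2 * k / (1 + k ^+ 2)
    & c = (1 - k ^+ 2) / (1 + k ^+ 2)].
Proof.
move=> E s0 k.
have ck : c = 1 - k * s by rewrite /k divfK//; ring.
have : s * (s * (1 + k ^+ 2)) = s * (2 * k).
  by have := E; rewrite ck => E'; rewrite mulrDr mulr1 mulrDr -expr2 E'; ring.
move/(mulfI s0) => E2.
have k0 : 1 + k ^+ 2 != 0 by rewrite gt_eqF// ltr_pwDl// sqr_ge0.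
have sE : s = 2 * k / (1 + k ^+ 2) by rewrite -E2 mulfK.
by split=> //; rewrite ck {1}sE; field.
Qed.

Lemma cc1k : cc1 R N = 2 * cot1 ^+ 2 / (1 + cot1 ^+ 2).
Proof.
have s0 : s1 R N != 0 by rewrite gt_eqF ?s1_gt0.
by case: (half_angle (sin2cos2 _) s0).
Qed.
Lemma s1k : s1 R N = 2 * cot1 / (1 + cot1 ^+ 2).
Proof.
have s0 : s1 R N != 0 by rewrite gt_eqF ?s1_gt0.
by case: (half_angle (sin2cos2 _) s0).
Qed.
Lemma c1k : c1 R N = (1 - cot1 ^+ 2) / (1 + cot1 ^+ 2).
Proof.
have s0 : s1 R N != 0 by rewrite gt_eqF ?s1_gt0.
by case: (half_angle (sin2cos2 _) s0).
Qed.
Lemma cc2k : cc2 R N = 2 * cot2 ^+ 2 / (1 + cot2 ^+ 2).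
Proof.
have s0 : s2 R N != 0 by rewrite s2E// gt_eqF ?s_gt0.
by case: (half_angle (sin2cos2 _) s0).
Qed.
Lemma s2k : s2 R N = 2 * cot2 / (1 + cot2 ^+ 2).
Proof.
have s0 : s2 R N != 0 by rewrite s2E// gt_eqF ?s_gt0.
by case: (half_angle (sin2cos2 _) s0).
Qed.
Lemma c2k : c2 R N = (1 - cot2 ^+ 2) / (1 + cot2 ^+ 2).
Proof.
have s0 : s2 R N != 0 by rewrite s2E// gt_eqF ?s_gt0.
by case: (half_angle (sin2cos2 _) s0).
Qed.

(** The generators v0, ..., v3 of C0. The first and third coordinates of v0 and v2
vanish, so B fixes both; v3 = v2 + (- R)^-1 v2, while v1 and v3 have the same
y-coordinates. *)
Definition v0 : 'cV[R]_4 := vec4 0 (- L1 * cot1) 0 (L2 * cot2).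
Definition v1 : 'cV[R]_4 :=
  vec4 (- L2 * cc1 R N) (- cc1 R N * cot1) (L1 * cc2 R N) (cc2 R N * cot2).
Definition v2 : 'cV[R]_4 := vec4 0 (- cot1) 0 cot2.
Definition v3 : 'cV[R]_4 :=
  vec4 (cc1 R N) (- cc1 R N * cot1) (- cc2 R N) (cc2 R N * cot2).

Lemma matV_vec4 (a0 a1 a2 a3 : R) :
  matV R N *m vec4 a0 a1 a2 a3 =
  a0 *: v0 + a1 *: v1 + a2 *: v2 + a3 *: v3.
Proof.
rewrite mx4_vec4; apply/matrixP => i j; rewrite !mxE /cot1 /cot2.
by case: i => [[|[|[|[|//]]]] ?] /=; ring.
Qed.

(** Row i gives L2 - L1 times the coordinate of A x on v_i. The second row h is the
simplest: it kills v0, v2 and v3. The first row is h + h (- R), by which its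
signs follow from those of h. *)
Definition matW : 'M[R]_4 := mx4
  [:: [:: 1; cot1^-1; 1; cot2^-1];
      [:: (cc1 R N)^-1; 0; (cc2 R N)^-1; 0];
      [:: 1; - L2 / cot1; 1; - L1 / cot2];
      [:: L1 / cc1 R N; 0; L2 / cc2 R N; 0]].

(** The choice of L1 and L2 makes 1 + L1 and 1 + L2 proportional to cc1 and cc2; this
is what makes A a diagonal sign matrix in the basis v0, ..., v3. *)
Lemma L_cc : (1 + L1) * (cc2 R N - cc1 R N) = (L2 - L1) * cc1 R N /\
             (1 + L2) * (cc2 R N - cc1 R N) = (L2 - L1) * cc2 R N.
Proof.
by split; apply: (mulIf (denL_neq0 R hN)); rewrite mulrAC [RHS]mulrAC;
  rewrite mulrDl mulrBl L1_denL// L2_denL// cc1u// cc2u// /denL; ring.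
Qed.

Lemma cc_diff_neq0 : cc2 R N - cc1 R N != 0.
Proof.
rewrite cc2u// cc1u//.
have -> : 1 + cos t - (1 + cos t) * (2 * cos t - 1) ^+ 2 =
  4 * cos t * (sin t) ^+ 2 :> R by rewrite sin_sq; ring.
by have [u0 _] := u_bounds R hN; rewrite !mulf_neq0 ?expf_neq0// gt_eqF ?s_gt0.
Qed.

Lemma r1E : (L2 - L1) * r1 R N = 2 * cot1 * (1 + L1).
Proof.
apply: (mulIf cc_diff_neq0); rewrite -(mulrA (2 * cot1)) L_cc.1 /r1 /cot1.
have -> : c1 R N - c2 R N = cc2 R N - cc1 R N by rewrite /cc1 /cc2; ring.
have -> : c1 R N - 1 = - cc1 R N by rewrite /cc1; ring.
by have := cc_diff_neq0; have := lt0r_neq0 (s1_gt0 R hN) => *; field; apply/andP.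
Qed.

Lemma r2E : (L2 - L1) * r2 R N = - 2 * cot2 * (1 + L2).
Proof.
apply: (mulIf cc_diff_neq0); rewrite -(mulrA (- 2 * cot2)) L_cc.2 /r2 /cot2.
have -> : c2 R N - c1 R N = - (cc2 R N - cc1 R N) by rewrite /cc1 /cc2; ring.
have -> : c2 R N - 1 = - cc2 R N by rewrite /cc2; ring.
have := cc_diff_neq0; have : s2 R N != 0 by rewrite s2E// gt_eqF ?s_gt0.
by move=> *; field; apply/andP.
Qed.

Lemma matVW : matV R N *m matW = (L2 - L1) *: matA R N.
Proof.
apply: eq_mx_vec4 => a b c d.
rewrite -scalemxAl -mulmxA !mx4_vec4 scale_vec4 /cot1 /cot2.
have s20 : s2 R N != 0 by rewrite s2E// gt_eqF ?s_gt0.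
have := lt0r_neq0 (s1_gt0 R hN); have := lt0r_neq0 (cc1_gt0 R hN).
have := lt0r_neq0 (cc2_gt0 R hN) => c20 c10 s10.
have L2E : L2 = (1 + L1) * cc2 R N / cc1 R N - 1.
  have [E1 E2] := L_cc; apply: (mulIf c10); rewrite mulrBl divfK// mul1r.
  have : cc2 R N * ((1 + L1) * (cc2 R N - cc1 R N)) =
         cc1 R N * ((1 + L2) * (cc2 R N - cc1 R N)) by rewrite E1 E2; ring.
  rewrite !mulrA => /(mulIf cc_diff_neq0) E.
  by rewrite (mulrC (1 + L1)) E; ring.
congr vec4; last 3 first.
- transitivity (- ((L2 - L1) * r1 R N) * (a + c) + (L2 - L1) * b); last by ring.
  by rewrite r1E /cot1 L2E; field; rewrite ?c10 ?c20 ?s10 ?s20.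
- by field; rewrite ?c10 ?c20 ?s10 ?s20.
- transitivity (- ((L2 - L1) * r2 R N) * (a + c) + (L2 - L1) * d); last by ring.
  by rewrite r2E /cot2 L2E; field; rewrite ?c10 ?c20 ?s10 ?s20.
by field; rewrite ?c10 ?c20 ?s10 ?s20.
Qed.

(** Seven of the entries of W (rotmx x v_j) and W (rotmx x (B v_j)), the rows of W being
counted from 0. All the entries are sums of values of these functions at x,
pi - x and their translates by multiples of t. *)
Definition row1_v0 (x : R) := L2 * sin x / s2 R N - L1 * sin (3 * x) / s1 R N.
Definition row1_v1 (x : R) :=
  L1 * cos x + cot2 * sin x - (L2 * cos (3 * x) + cot1 * sin (3 * x)).
Definition row1_v2 (x : R) := sin x / s2 R N - sin (3 * x) / s1 R N.
Definition row3_v0 (x : R) :=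
  L2 ^+ 2 * sin x / s2 R N - L1 ^+ 2 * sin (3 * x) / s1 R N.
Definition row3_v1 (x : R) :=
  L1 * L2 * (cos x - cos (3 * x)) + L2 * cot2 * sin x - L1 * cot1 * sin (3 * x).
Definition row2_v1 (x : R) :=
  cc2 R N * (L1 ^+ 2 / cot2 + cot2) * sin x
  - cc1 R N * (L2 ^+ 2 / cot1 + cot1) * sin (3 * x).
Definition row2_Bv1 (x : R) :=
  2 * (L2 * cc1 R N * cos (3 * x) - L1 * cc2 R N * cos x)
  + cc2 R N * (cot2 - L1 ^+ 2 / cot2) * sin x
  - cc1 R N * (cot1 - L2 ^+ 2 / cot1) * sin (3 * x).

Local Notation s3tE := (etrans (esym (s1E R hN)) s1k).
Local Notation stE := (etrans (esym (s2E R hN)) s2k).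
Lemma c3tE : cos (3 * t) = (cot1 ^+ 2 - 1) / (1 + cot1 ^+ 2).
Proof. by apply: oppr_inj; rewrite -c1E// c1k -[RHS]mulNr opprB. Qed.
Lemma ctE : cos t = (cot2 ^+ 2 - 1) / (1 + cot2 ^+ 2).
Proof. by apply: oppr_inj; rewrite -c2E// c2k -[RHS]mulNr opprB. Qed.

Lemma cospiB (x : R) : cos (pi - x) = - cos x.
Proof. by rewrite cosB cospi sinpi mul0r addr0 mulN1r. Qed.
Lemma sinpiB (x : R) : sin (pi - x) = sin x.
Proof. by rewrite sinB cospi sinpi mul0r sub0r mulN1r opprK. Qed.
Lemma cos3piB (x : R) : cos (3 * (pi - x)) = - cos (3 * x).
Proof. by rewrite !cos3E cospiB sinpiB mulNr. Qed.
Lemma sin3piB (x : R) : sin (3 * (pi - x)) = sin (3 * x).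
Proof. by rewrite !sin3E sinpiB. Qed.

(** Everything is brought to cos x, sin x, cos (3 x), sin (3 x) and the two half-angle
cotangents, where the identities are rational. *)
Ltac entries :=
  rewrite -?mulmxA !mx4_vec4 /row1_v0 /row1_v1 /row1_v2 /row3_v0 /row3_v1 /row2_v1 /row2_Bv1;
  rewrite ?(cospiB, sinpiB, cos3piB, sin3piB) ?(mulrDr 3) ?mulrN;
  rewrite ?(cosD, sinD) ?(cosN, sinN);
  rewrite ?c3tE ?ctE ?s3tE ?stE;
  rewrite ?cc1k ?cc2k ?s1k ?s2k;
  have := cot1_gt0; have := cot2_gt0; have := cot1sq_neq0; have := cot2sq_neq0;
  move=> ? ? /lt0r_neq0 ? /lt0r_neq0 ?;
  congr vec4; field; by do ?[apply/andP; split].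

Lemma W_v0 x : matW *m (rotmx x *m v0) =
  vec4 (row1_v0 x + row1_v0 (x + t)) (row1_v0 x) (row3_v1 (pi - x)) (row3_v0 x).
Proof. entries. Qed.

Lemma W_v1 x : matW *m (rotmx x *m v1) =
  vec4 (row1_v1 x + row1_v1 (x + t)) (row1_v1 x) (row2_v1 x) (row3_v1 x).
Proof. entries. Qed.

Lemma W_v2 x : matW *m (rotmx x *m v2) =
  vec4 (row1_v2 x + row1_v2 (x + t)) (row1_v2 x) (row1_v1 (pi - x)) (row1_v0 x).
Proof. entries. Qed.

Lemma W_v3 x : matW *m (rotmx x *m v3) =
  vec4 (row1_v2 (x - t) + row1_v2 x + (row1_v2 x + row1_v2 (x + t))) (row1_v2 (x - t) + row1_v2 x)
    (row1_v1 (pi - x) + row1_v1 (pi - (x - t))) (row1_v0 (x - t) + row1_v0 x).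
Proof. entries. Qed.

Lemma W_Bv0 x : matW *m (rotmx x *m (matB R *m v0)) =
  vec4 (row1_v0 x + row1_v0 (x + t)) (row1_v0 x) (row3_v1 (pi - x)) (row3_v0 x).
Proof. entries. Qed.

Lemma W_Bv1 x : matW *m (rotmx x *m (matB R *m v1)) =
  vec4 (row1_v1 (pi - (x + t)) + row1_v1 (pi - x)) (row1_v1 (pi - x))
    (row2_Bv1 x) (row3_v1 (pi - x)).
Proof. entries. Qed.

Lemma W_Bv2 x : matW *m (rotmx x *m (matB R *m v2)) =
  vec4 (row1_v2 x + row1_v2 (x + t)) (row1_v2 x) (row1_v1 (pi - x)) (row1_v0 x).
Proof. entries. Qed.

Lemma W_Bv3 x : matW *m (rotmx x *m (matB R *m v3)) =
  vec4 (row1_v2 x + row1_v2 (x + t) + (row1_v2 (x + t) + row1_v2 (x + t + t)))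
    (row1_v2 x + row1_v2 (x + t))
    (row1_v1 (pi - (x + t)) + row1_v1 (pi - x)) (row1_v0 x + row1_v0 (x + t)).
Proof. entries. Qed.

End Entries.

(** * Signs of the seven trigonometric polynomials *)

Section Signs.
Variables (R : realType) (N : nat).
Hypothesis hN : (4 <= N)%N.

Local Notation t := (pi / N%:R : R).
Local Notation u := (cos t).
Local Notation s := (sin t).
Local Notation L1 := (L1 R N).
Local Notation L2 := (L2 R N).
Local Notation cot1 := (cot1 R N).
Local Notation cot2 := (cot2 R N).
Local Notation denL := (denL R N).

Lemma ler_denL (a b : R) : a * denL <= b * denL -> a <= b.
Proof. by rewrite ler_pM2r// (lt_trans _ (denL_gt R hN)). Qed.

Ltac bern n := bernstein n (u_ge R hN) (u_lt1 R hN).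

Lemma L1_ge : - (3 / 4) <= L1.
Proof. by apply: ler_denL; rewrite L1_denL// /denL; bern 3%N. Qed.
Lemma L1_le : L1 <= 1 / 2.
Proof. by apply: ler_denL; rewrite L1_denL// /denL; bern 3%N. Qed.
Lemma L2_ge : 1 / 2 <= L2.
Proof. by apply: ler_denL; rewrite L2_denL// /denL; bern 3%N. Qed.
Lemma L2_le : L2 <= 9 / 10.
Proof. by apply: ler_denL; rewrite L2_denL// /denL; bern 3%N. Qed.

Lemma L_sq_le : L1 ^+ 2 <= L2 ^+ 2.
Proof.
by have := L_lt R hN; have := L_sum_ge0 R hN; rewrite -subr_ge0; nra.
Qed.

(** L1 and L2 have the same limit 1/2 as t tends to 0; the factor 1 - cos t measures
the room left, which several inequalities below have to share. *)
Lemma L_diff : L2 - L1 = 4 * (1 + L2) * u * (1 - u).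
Proof.
apply: (mulIf (denL_neq0 R hN)); rewrite mulrBl L1_denL// L2_denL//.
transitivity (4 * (denL + L2 * denL) * u * (1 - u)); last by ring.
by rewrite L2_denL// /denL; ring.
Qed.

Lemma cot2u : cot2 = (1 + u) / s.
Proof. by rewrite /cot2 cc2u// s2E. Qed.

Lemma cot1u : cot1 = (1 + u) * (2 * u - 1) / (s * (2 * u + 1)).
Proof.
have s0 := lt0r_neq0 (s_gt0 R hN); have u7 := u_ge R hN.
rewrite /cot1 cc1u// s1u//.
have -> : 4 * u ^+ 2 - 1 = (2 * u - 1) * (2 * u + 1) by ring.
have h1 : 2 * u - 1 != 0 by rewrite gt_eqF//; lra.
have h2 : 2 * u + 1 != 0 by rewrite gt_eqF//; lra.
by field; rewrite h1 h2 s0.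
Qed.

(** sin((k-1)t) sin((k+1)t) = sin(kt)^2 - sin(t)^2, and for 0 < k < N both factors
are nonnegative. *)
Lemma sin_angle_ge k : (0 < k < N)%N -> s <= sin (k%:R * t).
Proof.
case: k => // k /= kN; set x := _ * t.
have Ym : 0 <= sin (x - t).
  have -> : x - t = k%:R * t by rewrite /x -natr1; ring.
  by rewrite sin_angle_ge0// ltnW// ltnW.
have Yp : 0 <= sin (x + t).
  have -> : x + t = k.+2%:R * t by rewrite /x -!natr1; ring.
  by rewrite sin_angle_ge0.
have Y0 : 0 <= sin x by rewrite sin_angle_ge0// ltnW.
have := s_gt0 R hN; have := mulr_ge0 Ym Yp; rewrite sinB sinD.
have := sin2cos2 x; have := sin2cos2 t; have := sin_le1 x.
move: (sin x) (cos x) Y0 => Y X Y0 Y1 e1 e2.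
have -> : (Y * u - X * s) * (Y * u + X * s) = Y ^+ 2 * u ^+ 2 - s ^+ 2 * X ^+ 2.
  by ring.
have -> : X ^+ 2 = 1 - Y ^+ 2 by rewrite e2; ring.
have -> : u ^+ 2 = 1 - s ^+ 2 by rewrite e1; ring.
by nra.
Qed.

Lemma sin_angle_dichotomy k : (k <= N)%N ->
  sin (k%:R * t) = 0 \/ s <= sin (k%:R * t).
Proof.
rewrite leq_eqVlt => /orP[/eqP ->|kN]; first by rewrite Nt// sinpi; left.
case: k kN => [|k] kN; first by rewrite mul0r sin0; left.
by right; apply: sin_angle_ge.
Qed.

(** The function is sin x (a - 3 b + 4 b sin(x)^2), whose second factor is affine in
sin(x)^2. As sin x is 0 or lies in [sin t, 1], only the end points matter, and
3 - 4 sin(t)^2 = 4 cos(t)^2 - 1. *)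
Lemma odd_ge0 (a b : R) k : (k <= N)%N ->
  0 <= a + b -> 0 <= a - b * (4 * u ^+ 2 - 1) ->
  0 <= a * sin (k%:R * t) - b * sin (3 * (k%:R * t)).
Proof.
move=> kN ab1 ab2; rewrite sin3E.
have := sin_angle_dichotomy kN; have := sin_le1 (k%:R * t).
move: (sin _) => Y Y1 [->|Ys]; first by rewrite !(mul0r, mulr0) subr0.
have s0 := s_gt0 R hN; have us := sin_sq R N.
have -> : a * Y - b * (Y * (3 - 4 * Y ^+ 2)) = Y * (a - b * (3 - 4 * Y ^+ 2)).
  by ring.
apply: mulr_ge0; first by lra.
have E : (1 - s ^+ 2) * (a - b * (3 - 4 * Y ^+ 2)) =
  (a + b) * (Y ^+ 2 - s ^+ 2) + (a - b * (3 - 4 * s ^+ 2)) * (1 - Y ^+ 2) by ring.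
have s1 : 0 < 1 - s ^+ 2.
  have -> : 1 - s ^+ 2 = u ^+ 2 :> R by rewrite us; ring.
  by rewrite exprn_gt0//; case: (u_bounds R hN).
rewrite -(pmulr_rge0 _ s1) E; apply: addr_ge0; apply: mulr_ge0 => //.
- by nra.
- by have -> : 3 - 4 * s ^+ 2 = 4 * u ^+ 2 - 1 :> R by rewrite us; ring.
by nra.
Qed.

(** The cubic vanishing at the angles -t, 0 and t. *)
Lemma row1_v2E (x : R) : row1_v2 N x =
  4 * sin x * (sin x ^+ 2 - s ^+ 2) / (s * (4 * u ^+ 2 - 1)).
Proof.
have s0 := lt0r_neq0 (s_gt0 R hN); have [_ u2] := u_bounds R hN.
have h : 4 * u ^+ 2 - 1 != 0 by rewrite gt_eqF//; lra.
by rewrite /row1_v2 s1u// s2E// sin3E sin_sq; field; rewrite s0 h.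
Qed.

(** The zero at -t gives, by antiperiodicity, a zero at (N + 1) t, one step beyond the
range where the sine is nonnegative. *)
Lemma row1_v2_ge0 k : (k <= N.+1)%N -> 0 <= row1_v2 N (k%:R * t).
Proof.
have s0 := s_gt0 R hN; have [_ u2] := u_bounds R hN.
have h : 0 < s * (4 * u ^+ 2 - 1) by rewrite mulr_gt0//; lra.
move=> kN; rewrite row1_v2E; apply: divr_ge0 (ltW h).
move: kN; rewrite leq_eqVlt ltnS => /orP[/eqP ->|/sin_angle_dichotomy].
  have -> : N.+1%:R * t = t + pi by rewrite -natr1 mulrDl Nt// mul1r addrC.
  by rewrite sinDpi sqrrN subrr mulr0.
move: (sin (k%:R * t)) => Y [->|sY]; first by rewrite mulr0 mul0r.
by apply: mulr_ge0; [lra|nra].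
Qed.

Lemma row1_v0_ge0 k : (k <= N)%N -> 0 <= row1_v0 N (k%:R * t).
Proof.
move=> kN; rewrite /row1_v0 mulrAC [X in _ - X]mulrAC s2E//.
have s0 := s_gt0 R hN; have [_ u2] := u_bounds R hN.
have h : 0 < 4 * u ^+ 2 - 1 by lra.
have -> : L1 / s1 R N = L1 / (4 * u ^+ 2 - 1) / s.
  by rewrite s1u//; field; rewrite !gt_eqF.
apply: odd_ge0 => //.
  rewrite -mulrDl divr_ge0// ?(ltW s0)//.
  have -> : L2 + L1 / (4 * u ^+ 2 - 1) =
    (L2 * (4 * u ^+ 2 - 1) + L1) / (4 * u ^+ 2 - 1) by field; rewrite gt_eqF.
  by apply: divr_ge0 (ltW h); have := L_sum_ge0 R hN; have := L2_ge; nra.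
have -> : L2 / s - L1 / (4 * u ^+ 2 - 1) / s * (4 * u ^+ 2 - 1) = (L2 - L1) / s.
  by field; rewrite !gt_eqF.
by rewrite divr_ge0 ?ltW// L_lt.
Qed.

Lemma row3_v0_ge0 k : (k <= N)%N -> 0 <= row3_v0 N (k%:R * t).
Proof.
move=> kN; rewrite /row3_v0 mulrAC [X in _ - X]mulrAC s2E//.
have s0 := s_gt0 R hN; have [_ u2] := u_bounds R hN.
have h : 0 < 4 * u ^+ 2 - 1 by lra.
have -> : L1 ^+ 2 / s1 R N = L1 ^+ 2 / (4 * u ^+ 2 - 1) / s.
  by rewrite s1u//; field; rewrite !gt_eqF.
apply: odd_ge0 => //.
  by rewrite -mulrDl divr_ge0 ?(ltW s0)// addr_ge0 ?divr_ge0 ?sqr_ge0// ltW.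
have -> : L2 ^+ 2 / s - L1 ^+ 2 / (4 * u ^+ 2 - 1) / s * (4 * u ^+ 2 - 1) =
  (L2 ^+ 2 - L1 ^+ 2) / s by field; rewrite !gt_eqF.
by rewrite divr_ge0 ?(ltW s0)// subr_ge0 L_sq_le.
Qed.

Lemma row2_v1_ge0 k : (k <= N)%N -> 0 <= row2_v1 N (k%:R * t).
Proof.
move=> kN; rewrite /row2_v1.
have s0 := s_gt0 R hN; have [u0 u2] := u_bounds R hN.
have h7 := u_ge R hN.
apply: odd_ge0 => //.
  have [c1 c2] := (cc1_gt0 R hN, cc2_gt0 R hN).
  have [p1 p2] := (cot1_gt0 R hN, cot2_gt0 R hN).
  have q1 := addr_ge0 (divr_ge0 (sqr_ge0 L1) (ltW p2)) (ltW p2).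
  have q2 := addr_ge0 (divr_ge0 (sqr_ge0 L2) (ltW p1)) (ltW p1).
  exact: addr_ge0 (mulr_ge0 (ltW c2) q1) (mulr_ge0 (ltW c1) q2).
set e := (X in 0 <= X).
have -> : e = s * (8 * u * (1 + u) * (2 * u ^+ 2 - 2 * u + 1) + L1 ^+ 2
                   - (L2 * (4 * u ^+ 2 - 1)) ^+ 2).
  have n0 := lt0r_neq0 s0.
  have n1 : 1 + u != 0 by rewrite gt_eqF//; lra.
  have n2 : 2 * u + 1 != 0 by rewrite gt_eqF//; lra.
  have n3 : 2 * u - 1 != 0 by rewrite gt_eqF//; lra.
  apply: (mulfI n0).
  have us := sin_sq R N.
  transitivity (s ^+ 2 * (L1 ^+ 2 - (L2 * (4 * u ^+ 2 - 1)) ^+ 2) +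
    (1 + u) ^+ 2 - (1 + u) ^+ 2 * (2 * u - 1) ^+ 4).
    by rewrite /e cot1u cot2u cc1u// cc2u//; field; rewrite n0 n1 n2 n3.
  transitivity (s ^+ 2 * (8 * u * (1 + u) * (2 * u ^+ 2 - 2 * u + 1) + L1 ^+ 2
                   - (L2 * (4 * u ^+ 2 - 1)) ^+ 2)); last by ring.
  by rewrite us; ring.
apply: mulr_ge0; first exact: ltW.
have a4 : 4 <= 8 * u * (1 + u) * (2 * u ^+ 2 - 2 * u + 1) by bern 4%N.
have l2 : L2 * (4 * u ^+ 2 - 1) <= 2.
  apply: ler_denL; rewrite mulrAC L2_denL// /denL; bern 5%N.
have l0 : 0 <= L2 * (4 * u ^+ 2 - 1).
  by rewrite mulr_ge0//; [have := L2_ge; lra|lra].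
have := sqr_ge0 L1; nra.
Qed.

(** The discriminant condition for the quadratic form in (sin x, sin t cos x) that
occurs in row1_v1_ge0. *)
Lemma L2_sq_le : (L2 * (2 * u + 1)) ^+ 2 <= 4 * u * (1 + u).
Proof.
apply: ler_denL; apply: ler_denL.
have -> : (L2 * (2 * u + 1)) ^+ 2 * denL * denL = (L2 * denL * (2 * u + 1)) ^+ 2 by ring.
by rewrite L2_denL// /denL; bern 8%N.
Qed.

Lemma row1_v1_pi (x : R) :
  row1_v1 N (pi - x) = (L2 - L1) * cos x - 4 * L2 * cos x * sin x ^+ 2 +
    4 * sin x * (u * (1 + u) * sin x ^+ 2 + s ^+ 2 * cos x ^+ 2)
      / (s * (2 * u + 1)).
Proof.
have s0 := lt0r_neq0 (s_gt0 R hN); have h7 := u_ge R hN.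
have h2 : 2 * u + 1 != 0 by rewrite gt_eqF//; lra.
rewrite /row1_v1 cospiB sinpiB cos3piB sin3piB cos3E sin3E cot1u cot2u cos2sin2 sin_sq.
by field; rewrite h2 s0.
Qed.

Lemma row1_v1_pi_row1_v2 (x : R) : row1_v1 N (pi - x) = row1_v2 N x + row1_v2 N (x + t) -
  4 * (1 + L2) * cos x * (sin x ^+ 2 - u * (1 - u)).
Proof.
have s0 := lt0r_neq0 (s_gt0 R hN); have h7 := u_ge R hN.
have h2 : 2 * u + 1 != 0 by rewrite gt_eqF//; lra.
have h1 : 2 * u - 1 != 0 by rewrite gt_eqF//; lra.
rewrite row1_v1_pi !row1_v2E L_diff sinD.
have := sin2cos2 x; move: (sin x) (cos x) => Y X eY.
have K : (2 * u - 1) * (X * Y ^+ 2 * s * (2 * u + 1) +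
    Y * (u * (1 + u) * Y ^+ 2 + s ^+ 2 * X ^+ 2)) =
  Y * (Y ^+ 2 - s ^+ 2) + (Y * u + X * s) * ((Y * u + X * s) ^+ 2 - s ^+ 2).
  have eX : X ^+ 2 = 1 - Y ^+ 2 by rewrite eY; ring.
  have eS : s ^+ 2 = 1 - u ^+ 2 := sin_sq R N.
  by ring: eX eS.
have -> : 4 * u ^+ 2 - 1 = (2 * u - 1) * (2 * u + 1) by ring.
apply/eqP; rewrite -subr_eq0; apply/eqP.
move/eqP: K; rewrite -subr_eq0 => /eqP K.
transitivity (4 * 0 / (s * (2 * u - 1) * (2 * u + 1))); last by ring.
by rewrite -K; field; rewrite s0 h1 h2.
Qed.

(** In terms of x = pi - k t. When cos x >= 0, factoring out sin x leaves, next to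
(L2 - L1) cos x, a nonnegative quadratic form. When cos x < 0, both values of
row1_v2 are nonnegative and the correction has the right sign because
sin(x)^2 >= 1 - cos(t)^2 >= cos t (1 - cos t). *)
Lemma row1_v1_ge0 k : (0 < k <= N)%N -> 0 <= row1_v1 N (k%:R * t).
Proof.
case/andP=> k0 kN; have s0 := s_gt0 R hN; have h7 := u_ge R hN.
have h1 := u_lt1 R hN; have us := sin_sq R N.
pose j := (N - k)%N; have jN : (j < N)%N by rewrite /j ltn_subrL k0 (leq_trans k0).
have -> : k%:R * t = pi - j%:R * t.
  by rewrite /j natrB// mulrBl Nt//; ring.
have Y0 : 0 <= sin (j%:R * t) by rewrite sin_angle_ge0// ltnW.
case: (lerP 0 (cos (j%:R * t))) => X0.
  rewrite row1_v1_pi; move: X0 Y0; move: (cos (_ * t)) (sin (_ * t)) => X Y X0 Y0.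
  have h2 : 0 < 2 * u + 1 by lra.
  have -> : (L2 - L1) * X - 4 * L2 * X * Y ^+ 2 +
    4 * Y * (u * (1 + u) * Y ^+ 2 + s ^+ 2 * X ^+ 2) / (s * (2 * u + 1)) =
    (L2 - L1) * X + 4 * Y / (s * (2 * u + 1)) * (u * (1 + u) * Y ^+ 2 +
       s ^+ 2 * X ^+ 2 - L2 * (2 * u + 1) * s * X * Y).
    by field; rewrite !gt_eqF.
  apply: addr_ge0; first by rewrite mulr_ge0 ?(ltW (L_lt _ _)).
  apply: mulr_ge0.
    by apply: divr_ge0; apply: mulr_ge0 => //; exact: ltW.
  have D := L2_sq_le.
  have L0 := L2_ge.
  have q0 : 0 < 4 * u * (1 + u) by nra.
  rewrite -(pmulr_rge0 _ q0).
  have := sqr_ge0 (2 * u * (1 + u) * Y - L2 * (2 * u + 1) * (s * X)).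
  move: D; move: (L2 * (2 * u + 1)) => q D D1.
  have D2 : 0 <= (s * X) ^+ 2 * (4 * u * (1 + u) - q ^+ 2).
    by rewrite mulr_ge0 ?sqr_ge0// subr_ge0.
  by nra.
rewrite row1_v1_pi_row1_v2.
have Y1 : s <= sin (j%:R * t).
  case: (posnP j) => [j0|j0]; last by apply: sin_angle_ge; rewrite j0.
  by move: X0; rewrite j0 mul0r cos0 ltr10.
have -> : j%:R * t + t = j.+1%:R * t by rewrite -natr1; ring.
have jN1 : (j.+1 <= N.+1)%N by rewrite ltnS ltnW.
have := row1_v2_ge0 (ltnW jN1); have := row1_v2_ge0 jN1; have L0 := L2_ge.
move: (row1_v2 _ _) (row1_v2 _ _) => a b a0 b0.
move: (cos (_ * t)) (sin (_ * t)) X0 Y1 Y0 => X Y X0 Y1 Y0.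
have h : 0 <= Y ^+ 2 - u * (1 - u) by nra.
have := mulr_ge0 (mulr_ge0 (_ : 0 <= 4 * (1 + L2)) (_ : 0 <= - X)) h.
by move=> /(_ ltac:(lra) ltac:(lra)); lra.
Qed.

(** After factoring out sin x there remains a quadratic form in (cos x, sin x). If
L1 >= 0, completing the square reduces its positivity to that of L2 - L1, which
is of the same order as sin(t)^2. If L1 < 0, which happens only for small N,
crude bounds on L1, L2 and sin t suffice. *)
Lemma row3_v1_ge0 k : (k <= N)%N -> 0 <= row3_v1 N (k%:R * t).
Proof.
move=> kN; have s0 := s_gt0 R hN; have h7 := u_ge R hN.
have h1 := u_lt1 R hN; have us := sin_sq R N.
have h2 : 0 < 2 * u + 1 by lra.
have -> : row3_v1 N (k%:R * t) = sin (k%:R * t) / s *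
   (4 * L1 * L2 * s * cos (k%:R * t) * sin (k%:R * t) + (1 + u) *
   (L2 - L1 * ((2 * u - 1) / (2 * u + 1)) * (3 - 4 * sin (k%:R * t) ^+ 2))).
  rewrite /row3_v1 cot1u cot2u cos3E sin3E; move: (cos (_ * t)) (sin (_ * t)) => X Y.
  by field; rewrite !gt_eqF.
case: (sin_angle_dichotomy kN) => [->|]; first by rewrite !mul0r.
have := cos2Dsin2 (k%:R * t).
move: (cos (_ * t)) (sin (_ * t)) => X Y XY sY.
apply: mulr_ge0; first by rewrite divr_ge0 ?ltW// (lt_le_trans s0).
set r := (2 * u - 1) / (2 * u + 1).
have r1 : r <= 1 / 3 by rewrite ler_pdivrMr//; lra.
have r0 : 1 / 6 <= r by rewrite ler_pdivlMr//; lra.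
have XY1 : -1 <= 2 * (X * Y) <= 1.
  by have := sqr_ge0 (X - Y); have := sqr_ge0 (X + Y) => *; apply/andP; split; nra.
have L2g := L2_ge; have L2l := L2_le; have Lam := L_diff.
have L12 := L_sum_ge0 R hN.
set A := (1 + u) * r; have A0 : 17 / 60 <= A by rewrite /A; nra.
have X1 : X ^+ 2 <= 1 by have := sqr_ge0 Y; lra.
case: (lerP 0 L1) => L0.
  have L1l := L1_le.
  have L3 : L2 - L1 <= L2 - 3 * r * L1 by nra.
  have T1 : - (s ^+ 2 * L2 ^+ 2) <= A * (4 * A * Y ^+ 2 + 4 * s * L2 * X * Y).
    have := sqr_ge0 (2 * A * Y + s * L2 * X).
    have := mulr_ge0 (sqr_ge0 (s * L2)) (_ : 0 <= 1 - X ^+ 2).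
    by rewrite subr_ge0 => /(_ X1); nra.
  have T2 : L1 * L2 ^+ 2 <= 4 * A * (1 + L2) * u.
    have : L1 * L2 ^+ 2 <= 1 / 2.
      have : L2 ^+ 2 <= 1 by nra.
      by have := sqr_ge0 L2; nra.
    have : 1 <= (1 + L2) * u by nra.
    by move: (_ * u) => z; rewrite -mulrA => *; nra.
  have A1 : 0 < A by lra.
  rewrite -(pmulr_rge0 _ A1).
  have -> : A * (4 * L1 * L2 * s * X * Y + (1 + u) * (L2 - L1 * r * (3 - 4 * Y ^+ 2)))
     = L1 * (A * (4 * A * Y ^+ 2 + 4 * s * L2 * X * Y))
       + A * (1 + u) * (L2 - 3 * r * L1) by rewrite /A; ring.
  have T3 : A * (1 + u) * (L2 - L1) <= A * (1 + u) * (L2 - 3 * r * L1).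
    by rewrite ler_pM2l// mulr_gt0//; lra.
  have T4 := ler_wpM2l L0 T1.
  have T5 : 0 <= A * (1 + u) * (L2 - L1) + L1 * (- (s ^+ 2 * L2 ^+ 2)).
    rewrite L_diff us.
    have -> : A * (1 + u) * (4 * (1 + L2) * u * (1 - u)) +
      L1 * - ((1 - u ^+ 2) * L2 ^+ 2) =
      (1 - u) * (1 + u) * (4 * A * (1 + L2) * u - L1 * L2 ^+ 2) by ring.
    by rewrite mulr_ge0// ?subr_ge0// mulr_ge0//; lra.
  by lra.
have L1g := L1_ge; have s1 : s <= 18 / 25 by nra.
case/andP: XY1 => _ XY1.
have T1 : - (9 / 8 * L2) <= 4 * L1 * L2 * s * X * Y.
  have a1 : - (27 / 25) * L2 <= 2 * L1 * s * L2.
    by rewrite ler_pM2r//; [nra|lra].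
  have a2 : 2 * L1 * s * L2 <= 2 * L1 * s * L2 * (2 * (X * Y)).
    have c1 : 0 <= s * L2 * - L1 by apply: mulr_ge0; [apply: mulr_ge0|]; lra.
    have : 2 * L1 * s * L2 <= 0 by lra.
    by move: (2 * L1 * s * L2) (2 * (X * Y)) XY1 => c z z1 c0; nra.
  have -> : 4 * L1 * L2 * s * X * Y = 2 * L1 * s * L2 * (2 * (X * Y)) by ring.
  by lra.
have T2 : L2 * (2 / 3) <= L2 - L1 * r * (3 - 4 * Y ^+ 2).
  have : 0 <= - (L1 * r) * (1 - Y ^+ 2).
    by apply: mulr_ge0; [nra|have := sqr_ge0 X; lra].
  by nra.
have : (17 / 10) * (L2 * (2 / 3)) <= (1 + u) * (L2 - L1 * r * (3 - 4 * Y ^+ 2)).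
  by apply: ler_pM => //; lra.
by lra.
Qed.

(** As a binary cubic in X = cos x and Y = sin x this is
8 u s^2 X^3 + s P X^2 Y - M X Y^2 + (S / s) Y^3 with u = cos t, s = sin t,
P >= 8 u, S >= 2 u and - 2 u <= M <= 8 u. For X >= 0 the last three terms are at
least (2 u Y / s) (2 s X - Y)^2. For X < 0 one has Y >= s, and the second and
fourth terms dominate the two others. *)
Lemma row2_Bv1_ge0 k : (k < N)%N -> 0 <= row2_Bv1 N (k%:R * t).
Proof.
move=> kN; have s0 := s_gt0 R hN; have h7 := u_ge R hN.
have h1 := u_lt1 R hN; have us := sin_sq R N.
have h2 : 0 < 2 * u + 1 by lra.
have h3 : 0 < 2 * u - 1 by lra.
have L2g := L2_ge; have L2l := L2_le.
pose P := 4 * (1 + u) * (6 * u ^+ 2 - 3 * u + 1) / (2 * u + 1) - L1 ^+ 2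
  + 3 * L2 ^+ 2 * (4 * u ^+ 2 - 1).
pose S := (1 + u) ^+ 2 - L1 ^+ 2 * s ^+ 2
  + (1 + u) ^+ 2 * (2 * u - 1) ^+ 3 / (2 * u + 1)
  - L2 ^+ 2 * s ^+ 2 * (4 * u ^+ 2 - 1).
pose M := (1 + u) * (6 * L2 * (2 * u - 1) ^+ 2 + 2 * L1).
have P_ge : 8 * u <= P.
  have a1 : 2 * (3 * u ^+ 2 - 1) <= 2 * (3 * L2 ^+ 2 * (4 * u ^+ 2 - 1) - L1 ^+ 2).
    have := L_sq_le; have : 1 / 4 <= L2 ^+ 2 by nra.
    move: (L1 ^+ 2) (L2 ^+ 2) => a b b0 ab; have u2 : 0 <= 3 * u ^+ 2 - 1 by nra.
    by have := mulr_ge0 u2 (_ : 0 <= b - 1 / 4); rewrite subr_ge0 => /(_ b0); nra.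
  have a2 : 8 * u - (3 * u ^+ 2 - 1) <= 
     4 * (1 + u) * (6 * u ^+ 2 - 3 * u + 1) / (2 * u + 1).
    by rewrite ler_pdivlMr//; bern 3%N.
  by rewrite /P; lra.
have S_ge : 2 * u <= S.
  have a1 : 0 <= (1 + u) ^+ 2 * (2 * u - 1) ^+ 3 / (2 * u + 1).
    by rewrite divr_ge0 ?mulr_ge0 ?exprn_ge0// ltW//; lra.
  have : L2 ^+ 2 <= 1 by nra.
  have := L_sq_le; rewrite /S us; move: (L1 ^+ 2) (L2 ^+ 2) a1 => a b.
  move: (_ / _) => c c0 ab b1.
  have u2 : 0 <= 1 - u ^+ 2 by nra.
  have u3 : 0 <= 4 * u ^+ 2 - 1 by nra.
  have := mulr_ge0 u2 (_ : 0 <= 1 - a); rewrite subr_ge0 => /(_ (le_trans ab b1)).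
  have := mulr_ge0 (mulr_ge0 u2 u3) (_ : 0 <= 1 - b); rewrite subr_ge0 => /(_ b1).
  have := sqr_ge0 (2 * u ^+ 2 - 1).
  by nra.
have M_le : M <= 8 * u.
  apply: ler_denL; rewrite /M.
  have -> : (1 + u) * (6 * L2 * (2 * u - 1) ^+ 2 + 2 * L1) * denL =
    (1 + u) * (6 * (L2 * denL) * (2 * u - 1) ^+ 2 + 2 * (L1 * denL)) by ring.
  by rewrite L1_denL// L2_denL// /denL; bern 6%N.
have M_ge : - (2 * u) <= M.
  apply: ler_denL; rewrite /M.
  have -> : (1 + u) * (6 * L2 * (2 * u - 1) ^+ 2 + 2 * L1) * denL =
    (1 + u) * (6 * (L2 * denL) * (2 * u - 1) ^+ 2 + 2 * (L1 * denL)) by ring.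
  by rewrite L1_denL// L2_denL// /denL; bern 6%N.
have E : row2_Bv1 N (k%:R * t) = 2 * (4 * u * s ^+ 2) * cos (k%:R * t) ^+ 3
    + s * P * cos (k%:R * t) ^+ 2 * sin (k%:R * t)
    - M * cos (k%:R * t) * sin (k%:R * t) ^+ 2 + S / s * sin (k%:R * t) ^+ 3.
  have D : L1 * (1 + u) = L2 * cc1 R N - 4 * u * s ^+ 2.
    apply: (mulIf (denL_neq0 R hN)).
    transitivity ((L1 * denL) * (1 + u)); first by ring.
    transitivity ((L2 * denL) * cc1 R N - 4 * u * s ^+ 2 * denL); last by ring.
    by rewrite L1_denL// L2_denL// cc1u// us /denL; ring.
  have us' : 1 - u ^+ 2 = s ^+ 2 by rewrite us.
  have a1 : cc2 R N * (cot2 - L1 ^+ 2 / cot2) = (1 + u) ^+ 2 / s - L1 ^+ 2 * s.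
    by rewrite cc2u// cot2u; field; rewrite !gt_eqF//; lra.
  have b1 : cc1 R N * (cot1 - L2 ^+ 2 / cot1) =
      (1 + u) ^+ 2 * (2 * u - 1) ^+ 3 / (s * (2 * u + 1))
      - L2 ^+ 2 * s * (4 * u ^+ 2 - 1).
    by rewrite cc1u// cot1u; field; rewrite !gt_eqF//; lra.
  have sP : s * P = cc2 R N * (cot2 - L1 ^+ 2 / cot2) - 3 * (cc1 R N * (cot1 - L2 ^+ 2 / cot1)).
    apply: (mulfI (lt0r_neq0 s0)).
    transitivity (4 * s ^+ 2 * (1 + u) * (6 * u ^+ 2 - 3 * u + 1) / (2 * u + 1)
        - s ^+ 2 * L1 ^+ 2 + 3 * s ^+ 2 * L2 ^+ 2 * (4 * u ^+ 2 - 1)).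
      by rewrite /P; field; rewrite gt_eqF.
    by rewrite a1 b1 us; field: us; rewrite !gt_eqF.
  have sS : S / s = cc2 R N * (cot2 - L1 ^+ 2 / cot2) + cc1 R N * (cot1 - L2 ^+ 2 / cot1).
    by rewrite a1 b1 /S; field; rewrite !gt_eqF.
  have M' : M = 6 * (L2 * cc1 R N) + 2 * (L1 * (1 + u)) by rewrite /M cc1u//; ring.
  have eX := cos2sin2 (k%:R * t).
  rewrite sP sS M' /row2_Bv1 cos3E sin3E [in L1 * cc2 R N]cc2u// D.
  move: eX (cc2 R N * _) (cc1 R N * (cot1 - _)) => eX a b.
  by ring: eX.
rewrite {}E.
have X1 : 0 <= 1 + cos (k%:R * t) by have := cos_geN1 (k%:R * t); lra.
have Y0 : 0 <= sin (k%:R * t) by rewrite sin_angle_ge0// ltnW.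
have Ys : cos (k%:R * t) < 0 -> s <= sin (k%:R * t).
  case: (posnP k) => [->|k0 _]; first by rewrite mul0r cos0 ltr10.
  by apply: sin_angle_ge; rewrite k0.
move: (cos (_ * t)) (sin (_ * t)) X1 Y0 Ys => X Y X1 Y0 Ys.
clearbody P S M.
case: (ltrP X 0) => X0; last first.
  have e1 : 8 * u * s * X ^+ 2 * Y <= s * P * X ^+ 2 * Y.
    by rewrite ler_wpM2r// ler_wpM2r ?sqr_ge0// [leRHS]mulrC ler_pM2r.
  have e2 : M * X * Y ^+ 2 <= 8 * u * X * Y ^+ 2.
    by rewrite ler_wpM2r ?sqr_ge0// ler_wpM2r.
  have e3 : 2 * u / s * Y ^+ 3 <= S / s * Y ^+ 3.
    by rewrite ler_wpM2r ?exprn_ge0// ler_pM2r ?invr_gt0.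
  have e4 : 0 <= 2 * (4 * u * s ^+ 2) * X ^+ 3.
    by rewrite mulr_ge0 ?exprn_ge0// mulr_ge0// mulr_ge0 ?sqr_ge0//; lra.
  have e5 : 0 <= 2 * u * Y / s * (2 * s * X - Y) ^+ 2.
    by rewrite mulr_ge0 ?sqr_ge0// divr_ge0 ?(ltW s0)// mulr_ge0//; lra.
  have e6 : 2 * u * Y / s * (2 * s * X - Y) ^+ 2 =
     8 * u * s * X ^+ 2 * Y - 8 * u * X * Y ^+ 2 + 2 * u / s * Y ^+ 3.
    by field; rewrite gt_eqF.
  by lra.
have {}Ys := Ys X0.
have e1 : 8 * u * s ^+ 2 * X ^+ 2 <= s * P * X ^+ 2 * Y.
  have -> : 8 * u * s ^+ 2 * X ^+ 2 = s * (8 * u) * X ^+ 2 * s by ring.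
  have h0 : 0 <= s * (8 * u) * X ^+ 2 by rewrite mulr_ge0 ?sqr_ge0// mulr_ge0//; lra.
  apply: ler_pM => //; first exact: ltW.
  by rewrite ler_wpM2r ?sqr_ge0// ler_pM2l.
have e2 : - (2 * u) * (- X) * Y ^+ 2 <= M * (- X) * Y ^+ 2.
  by rewrite ler_wpM2r ?sqr_ge0// ler_wpM2r//; lra.
have e3 : 2 * u * Y ^+ 2 <= S / s * Y ^+ 3.
  have -> : S / s * Y ^+ 3 = S * (Y / s) * Y ^+ 2 by field; rewrite gt_eqF.
  rewrite ler_wpM2r ?sqr_ge0//; have : 1 <= Y / s by rewrite ler_pdivlMr// mul1r.
  by move: (Y / s) => z z1; nra.
have e4 : 0 <= 8 * u * s ^+ 2 * X ^+ 2 * (1 + X).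
  by rewrite mulr_ge0// mulr_ge0 ?sqr_ge0// mulr_ge0 ?sqr_ge0//; lra.
have e5 : 0 <= 2 * u * Y ^+ 2 * (1 + X).
  by rewrite mulr_ge0// mulr_ge0 ?sqr_ge0//; lra.
by lra.
Qed.

End Signs.

(** * The equivariant quadratic map phi *)

Section Forms.
Variables (R : realType) (N : nat).
Hypothesis hN : (4 <= N)%N.

Local Notation t := (pi / N%:R : R).
Local Notation u := (cos t).
Local Notation s := (sin t).
Local Notation L1 := (L1 R N).
Local Notation L2 := (L2 R N).
Local Notation cot1 := (cot1 R N).
Local Notation cot2 := (cot2 R N).
Local Notation denL := (denL R N).

Let r : R := - 3 * (2 * u - 1).

(** The polar forms of the imaginary and real parts of phi(z) = r z1 conj(z2) + z2^2,
up to the factor 2. The value r = -3 would come from the Hessian covariant of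
binary cubics; the correction by 6 (1 - cos t) makes the sign conditions hold
for all N >= 4 at once. *)
Definition phi_im (v w : 'cV[R]_4) : R :=
  r * (v 1 0 * w 2 0 + w 1 0 * v 2 0 - v 0 0 * w 3 0 - w 0 0 * v 3 0)
  + 2 * (v 2 0 * w 3 0 + w 2 0 * v 3 0).
Definition phi_re (v w : 'cV[R]_4) : R :=
  r * (v 0 0 * w 2 0 + w 0 0 * v 2 0 + v 1 0 * w 3 0 + w 1 0 * v 3 0)
  + 2 * (v 2 0 * w 2 0 - v 3 0 * w 3 0).
(** The imaginary part of e^(-it) phi, which vanishes on the mirror of C as phi_im
vanishes on that of B. *)
Definition phi_wall (v w : 'cV[R]_4) : R := u * phi_im v w - s * phi_re v w.

Lemma vec4_0 (a b c d : R) : vec4 a b c d 0 0 = a. Proof. by rewrite mxE. Qed.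
Lemma vec4_1 (a b c d : R) : vec4 a b c d 1 0 = b. Proof. by rewrite mxE. Qed.
Lemma vec4_2 (a b c d : R) : vec4 a b c d 2 0 = c. Proof. by rewrite mxE. Qed.
Lemma vec4_3 (a b c d : R) : vec4 a b c d 3 0 = d. Proof. by rewrite mxE. Qed.
Definition vec4E := (vec4_0, vec4_1, vec4_2, vec4_3).

Lemma phi_im_rotmx x v : phi_im (rotmx x *m v) (rotmx x *m v) =
  cos (2 * x) * phi_im v v - sin (2 * x) * phi_re v v.
Proof.
have [a [b [c [d ->]]]] := vec4_eta v.
rewrite mx4_vec4 /phi_im /phi_re !vec4E.
have -> : 2 * x = x + x by ring.
by rewrite cosD sinD cos3E sin3E; have e := cos2sin2 x; ring: e.
Qed.

Lemma phi_re_rotmx x v : phi_re (rotmx x *m v) (rotmx x *m v) =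
  cos (2 * x) * phi_re v v + sin (2 * x) * phi_im v v.
Proof.
have [a [b [c [d ->]]]] := vec4_eta v.
rewrite mx4_vec4 /phi_im /phi_re !vec4E.
have -> : 2 * x = x + x by ring.
by rewrite cosD sinD cos3E sin3E; have e := cos2sin2 x; ring: e.
Qed.

Lemma phi_im_B v : phi_im (matB R *m v) (matB R *m v) = - phi_im v v.
Proof.
have [a [b [c [d ->]]]] := vec4_eta v.
by rewrite mx4_vec4 /phi_im !vec4E; ring.
Qed.

Lemma phi_re_B v : phi_re (matB R *m v) (matB R *m v) = phi_re v v.
Proof.
have [a [b [c [d ->]]]] := vec4_eta v.
by rewrite mx4_vec4 /phi_re !vec4E; ring.
Qed.

Lemma phi_imZ c v : phi_im (c *: v) (c *: v) = c ^+ 2 * phi_im v v.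
Proof. by rewrite /phi_im !mxE; ring. Qed.
Lemma phi_reZ c v : phi_re (c *: v) (c *: v) = c ^+ 2 * phi_re v v.
Proof. by rewrite /phi_re !mxE; ring. Qed.
Lemma phi_wallZ c v : phi_wall (c *: v) (c *: v) = c ^+ 2 * phi_wall v v.
Proof. by rewrite /phi_wall phi_imZ phi_reZ; ring. Qed.

(** The two forms on vectors whose y-coordinates are divided by sin t: this removes
sin t, and with the generators rescaled as below leaves polynomials in cos t. *)
Definition im_poly (x1 y1 x2 y2 x1' y1' x2' y2' : R) : R :=
  r * (y1 * x2' + y1' * x2 - x1 * y2' - x1' * y2) + 2 * (x2 * y2' + x2' * y2).
Definition wall_poly (x1 y1 x2 y2 x1' y1' x2' y2' : R) : R :=
  u * im_poly x1 y1 x2 y2 x1' y1' x2' y2' -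
  ((1 - u ^+ 2) * (r * (x1 * x2' + x1' * x2) + 2 * x2 * x2') +
   r * (y1 * y2' + y1' * y2) - 2 * y2 * y2').

Lemma phi_im_vec4 c c' x1 y1 x2 y2 x1' y1' x2' y2' :
  phi_im (c *: vec4 x1 (y1 / s) x2 (y2 / s)) (c' *: vec4 x1' (y1' / s) x2' (y2' / s))
  = c * c' / s * im_poly x1 y1 x2 y2 x1' y1' x2' y2'.
Proof. by rewrite !scale_vec4 /phi_im !vec4E /im_poly; ring. Qed.

Lemma phi_wall_vec4 c c' x1 y1 x2 y2 x1' y1' x2' y2' :
  phi_wall (c *: vec4 x1 (y1 / s) x2 (y2 / s)) (c' *: vec4 x1' (y1' / s) x2' (y2' / s))
  = c * c' / s * wall_poly x1 y1 x2 y2 x1' y1' x2' y2'.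
Proof.
rewrite !scale_vec4 /phi_wall /phi_im /phi_re !vec4E /wall_poly /im_poly -sin_sq.
by have s0 := lt0r_neq0 (s_gt0 R hN); field.
Qed.

Local Notation tp := (2 * u + 1).
Local Notation sg := (2 * u - 1).

Let l1 : R := 1 - 15 * u + 12 * u ^+ 2 + 4 * u ^+ 3.
Let l2 : R := 1 + 9 * u - 12 * u ^+ 2 + 4 * u ^+ 3.

Lemma L1E : L1 = l1 / denL.
Proof. by rewrite /l1 -L1_denL// mulfK// denL_neq0. Qed.
Lemma L2E : L2 = l2 / denL.
Proof. by rewrite /l2 -L2_denL// mulfK// denL_neq0. Qed.

Lemma tp_neq0 : tp != 0.
Proof. by have h7 := u_ge R hN; rewrite gt_eqF//; lra. Qed.
Lemma sg_neq0 : sg != 0.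
Proof. by have h7 := u_ge R hN; rewrite gt_eqF//; lra. Qed.
Lemma sgtp : 4 * u ^+ 2 - 1 = sg * tp.
Proof. by ring. Qed.

Ltac hat :=
  rewrite scale_vec4 ?L1E ?L2E /cot1 /cot2 ?s1u ?s2E ?cc1u ?cc2u ?sgtp//;
  congr vec4; field;
  rewrite ?(lt0r_neq0 (s_gt0 R hN)) ?(denL_neq0 R hN) ?tp_neq0 ?sg_neq0.

Lemma v0_hat : v0 R N = ((1 + u) / (tp * denL)) *: vec4 0 (- l1 * sg / s) 0 (l2 * tp / s).
Proof. by rewrite /v0; hat. Qed.
Lemma v1_hat : v1 R N = ((1 + u) / (tp * denL)) *: vec4 (- l2 * sg ^+ 2 * tp)
   (- (1 + u) * sg ^+ 3 * denL / s) (l1 * tp) ((1 + u) * tp * denL / s).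
Proof. by rewrite /v1; hat. Qed.
Lemma v2_hat : v2 R N = ((1 + u) / tp) *: vec4 0 (- sg / s) 0 (tp / s).
Proof. by rewrite /v2; hat. Qed.
Lemma v3_hat : v3 R N = ((1 + u) / tp) *: vec4 (sg ^+ 2 * tp)
   (- (1 + u) * sg ^+ 3 / s) (- tp) ((1 + u) * tp / s).
Proof. by rewrite /v3; hat. Qed.

Ltac bern n := bernstein n (u_ge R hN) (u_lt1 R hN).

Lemma hat_scale_gt0 : 0 < (1 + u) / tp /\ 0 < (1 + u) / (tp * denL).
Proof.
have h7 := u_ge R hN; have d0 := denL_gt R hN.
by split; apply: divr_gt0; rewrite ?mulr_gt0//; lra.
Qed.

Lemma scale_gt0 (a b : R) : 0 < a -> 0 < b -> 0 < a * b / s.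
Proof. by move=> a0 b0; rewrite divr_gt0 ?s_gt0// mulr_gt0. Qed.

(** Reduces a sign condition on a pair of generators to a polynomial inequality in
cos t. The bound cos t < 1 serves for the strict ones, since all these
polynomials are divisible by 1 - cos t. *)
Ltac form_sign n :=
  rewrite ?v0_hat ?v1_hat ?v2_hat ?v3_hat ?phi_im_vec4 ?phi_wall_vec4;
  (first [rewrite pmulr_rle0 | rewrite pmulr_rge0 | rewrite pmulr_rlt0
         | rewrite pmulr_rgt0]; last by [apply: scale_gt0; case: hat_scale_gt0]);
  rewrite /wall_poly /im_poly /l1 /l2 /denL /r;
  have := u_lt1 R hN; bern n.

Lemma phi_im00 : phi_im (v0 R N) (v0 R N) <= 0. Proof. form_sign 1%N. Qed.
Lemma phi_im01 : phi_im (v0 R N) (v1 R N) <= 0. Proof. form_sign 12%N. Qed.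
Lemma phi_im02 : phi_im (v0 R N) (v2 R N) <= 0. Proof. form_sign 1%N. Qed.
Lemma phi_im03 : phi_im (v0 R N) (v3 R N) <= 0. Proof. form_sign 12%N. Qed.
Lemma phi_im11 : phi_im (v1 R N) (v1 R N) <= 0. Proof. form_sign 12%N. Qed.
Lemma phi_im12 : phi_im (v1 R N) (v2 R N) <= 0. Proof. form_sign 12%N. Qed.
Lemma phi_im13 : phi_im (v1 R N) (v3 R N) <= 0. Proof. form_sign 12%N. Qed.
Lemma phi_im22 : phi_im (v2 R N) (v2 R N) <= 0. Proof. form_sign 1%N. Qed.
Lemma phi_im23 : phi_im (v2 R N) (v3 R N) <= 0. Proof. form_sign 12%N. Qed.
Lemma phi_im33 : phi_im (v3 R N) (v3 R N) < 0. Proof. form_sign 12%N. Qed.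

Lemma phi_wall00 : 0 <= phi_wall (v0 R N) (v0 R N). Proof. form_sign 12%N. Qed.
Lemma phi_wall01 : 0 <= phi_wall (v0 R N) (v1 R N). Proof. form_sign 12%N. Qed.
Lemma phi_wall02 : 0 <= phi_wall (v0 R N) (v2 R N). Proof. form_sign 12%N. Qed.
Lemma phi_wall03 : 0 <= phi_wall (v0 R N) (v3 R N). Proof. form_sign 12%N. Qed.
Lemma phi_wall11 : 0 <= phi_wall (v1 R N) (v1 R N). Proof. form_sign 12%N. Qed.
Lemma phi_wall12 : 0 <= phi_wall (v1 R N) (v2 R N). Proof. form_sign 12%N. Qed.
Lemma phi_wall13 : 0 <= phi_wall (v1 R N) (v3 R N). Proof. form_sign 12%N. Qed.
Lemma phi_wall22 : 0 < phi_wall (v2 R N) (v2 R N). Proof. form_sign 12%N. Qed.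
Lemma phi_wall23 : 0 <= phi_wall (v2 R N) (v3 R N). Proof. form_sign 12%N. Qed.
Lemma phi_wall33 : 0 <= phi_wall (v3 R N) (v3 R N). Proof. form_sign 12%N. Qed.

Definition cone0 : set 'cV[R]_4 := cone (fun i => col i (matV R N)).

Lemma cone0P v : cone0 v <-> exists a0 a1 a2 a3,
  [/\ 0 <= a0, 0 <= a1, 0 <= a2, 0 <= a3 &
      v = a0 *: v0 R N + a1 *: v1 R N + a2 *: v2 R N + a3 *: v3 R N].
Proof.
have E (a : 'I_4 -> R) : \sum_i a i *: col i (matV R N) =
    matV R N *m vec4 (a 0) (a 1) (a 2) (a 3).
  apply/matrixP => i j; rewrite summxE !mxE; apply: eq_bigr => k _.
  rewrite !mxE mulrC; congr (_ * _).
  by case: k => [[|[|[|[|//]]]] ?] /=; congr a; apply: val_inj.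
split=> [[a a0 ->]|[a0 [a1 [a2 [a3 [? ? ? ? ->]]]]]].
  by exists (a 0), (a 1), (a 2), (a 3); split=> //; rewrite E matV_vec4.
exists (fun i : 'I_4 => nth 0 [:: a0; a1; a2; a3] i); last first.
  by rewrite E matV_vec4.
by case=> [[|[|[|[|//]]]] ?].
Qed.

Lemma phi_im_expand (a0 a1 a2 a3 : R) (e0 e1 e2 e3 : 'cV[R]_4) :
  let w := a0 *: e0 + a1 *: e1 + a2 *: e2 + a3 *: e3 in
  phi_im w w =
  a0 * a0 * phi_im e0 e0 + a1 * a1 * phi_im e1 e1
  + a2 * a2 * phi_im e2 e2 + a3 * a3 * phi_im e3 e3
  + 2 * (a0 * a1 * phi_im e0 e1 + a0 * a2 * phi_im e0 e2 + a0 * a3 * phi_im e0 e3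
       + a1 * a2 * phi_im e1 e2 + a1 * a3 * phi_im e1 e3 + a2 * a3 * phi_im e2 e3).
Proof. by rewrite /phi_im !mxE; ring. Qed.

Lemma phi_wall_expand (a0 a1 a2 a3 : R) (e0 e1 e2 e3 : 'cV[R]_4) :
  let w := a0 *: e0 + a1 *: e1 + a2 *: e2 + a3 *: e3 in
  phi_wall w w =
  a0 * a0 * phi_wall e0 e0 + a1 * a1 * phi_wall e1 e1
  + a2 * a2 * phi_wall e2 e2 + a3 * a3 * phi_wall e3 e3
  + 2 * (a0 * a1 * phi_wall e0 e1 + a0 * a2 * phi_wall e0 e2 + a0 * a3 * phi_wall e0 e3
       + a1 * a2 * phi_wall e1 e2 + a1 * a3 * phi_wall e1 e3 + a2 * a3 * phi_wall e2 e3).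
Proof. by rewrite /phi_wall /phi_im /phi_re !mxE; ring. Qed.

(** With phi_wall_cone: phi maps C0 into the sector of the complex numbers of
argument between pi and pi + t. *)
Lemma phi_im_cone v : cone0 v -> phi_im v v <= 0.
Proof.
case/cone0P=> a0 [a1 [a2 [a3 [p0 p1 p2 p3 ->]]]].
rewrite phi_im_expand.
have P (a b x : R) : 0 <= a -> 0 <= b -> x <= 0 -> a * b * x <= 0.
  by move=> *; rewrite mulr_ge0_le0// mulr_ge0.
have := (P _ _ _ p0 p0 phi_im00, P _ _ _ p0 p1 phi_im01, P _ _ _ p0 p2 phi_im02,
  P _ _ _ p0 p3 phi_im03, P _ _ _ p1 p1 phi_im11, P _ _ _ p1 p2 phi_im12).
have := (P _ _ _ p1 p3 phi_im13, P _ _ _ p2 p2 phi_im22, P _ _ _ p2 p3 phi_im23,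
  P _ _ _ p3 p3 (ltW phi_im33)).
move=> [[[q1 q2] q3] q4] [[[[[q5 q6] q7] q8] q9] q10]; lra.
Qed.

Lemma phi_wall_cone v : cone0 v -> 0 <= phi_wall v v.
Proof.
case/cone0P=> a0 [a1 [a2 [a3 [p0 p1 p2 p3 ->]]]].
rewrite phi_wall_expand.
have P (a b x : R) : 0 <= a -> 0 <= b -> 0 <= x -> 0 <= a * b * x.
  by move=> *; rewrite !mulr_ge0.
have := (P _ _ _ p0 p0 phi_wall00, P _ _ _ p0 p1 phi_wall01, P _ _ _ p0 p2 phi_wall02,
  P _ _ _ p0 p3 phi_wall03, P _ _ _ p1 p1 phi_wall11, P _ _ _ p1 p2 phi_wall12).
have := (P _ _ _ p1 p3 phi_wall13, P _ _ _ p2 p2 (ltW phi_wall22), P _ _ _ p2 p3 phi_wall23,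
  P _ _ _ p3 p3 phi_wall33).
move=> [[[q1 q2] q3] q4] [[[[[q5 q6] q7] q8] q9] q10]; lra.
Qed.

(** The sum of v2 and v3 is such a point: v2 is on the mirror of B only, and v3 on
the mirror of C only. *)
Lemma cone_interior : exists v, [/\ cone0 v, phi_im v v != 0 & phi_wall v v != 0].
Proof.
exists (0 *: v0 R N + 0 *: v1 R N + 1 *: v2 R N + 1 *: v3 R N); split.
- by apply/cone0P; exists 0, 0, 1, 1; split.
- rewrite phi_im_expand !(mul0r, mul1r) lt_eqF//.
  by have := phi_im22; have := phi_im33; have := phi_im23; lra.
rewrite phi_wall_expand !(mul0r, mul1r) gt_eqF//.
by have := phi_wall22; have := phi_wall33; have := phi_wall23; lra.
Qed.

End Forms.

(** * A maps every other cone into C0 *)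

Section Dihedral.
Variables (R : realType) (N : nat).
Hypothesis hN : (4 <= N)%N.

Local Notation t := (pi / N%:R : R).
Local Notation C0 := (@cone0 R N).

Definition pos4 (v : 'cV[R]_4) := forall i, 0 <= v i 0.

Lemma pos4_vec4 (a b c d : R) :
  0 <= a -> 0 <= b -> 0 <= c -> 0 <= d -> pos4 (vec4 a b c d).
Proof. by move=> *; case=> [[|[|[|[|//]]]] ?]; rewrite mxE. Qed.

Lemma pos4D v w : pos4 v -> pos4 w -> pos4 (v + w).
Proof. by move=> pv pw i; rewrite mxE addr_ge0. Qed.

Lemma pos4Z a v : 0 <= a -> pos4 v -> pos4 (a *: v).
Proof. by move=> a0 pv i; rewrite mxE mulr_ge0. Qed.

Lemma pos4_cone v : pos4 v -> C0 (matV R N *m v).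
Proof.
have [a [b [c [d ->]]]] := vec4_eta v => p; apply/cone0P; exists a, b, c, d.
have p0 := p 0; have p1 := p 1; have p2 := p 2; have p3 := p 3.
by rewrite !vec4E in p0 p1 p2 p3; rewrite matV_vec4.
Qed.

(** The pair (p, k) stands for R^k B^p. For k < N these are, up to sign, the elements
of the dihedral group, each one once. *)
Definition dihmx (d : bool * nat) : 'M[R]_4 :=
  matR R N ^+ d.2 *m (if d.1 then matB R else 1%:M).

Lemma simplicial_coneE p k :
  simplicial_cone R N p k = [set dihmx (p, k) *m v | v in C0].
Proof.
rewrite /simplicial_cone /dihmx /=; case: p.
  apply/seteqP; split=> x [y].
    by case=> v Cv <- <-; exists v => //; rewrite mulmxA.
  by move=> Cy <-; exists (matB R *m y); [exists y|rewrite mulmxA].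
by apply/seteqP; split=> x [v Cv <-]; exists v => //; rewrite mulmx1.
Qed.

Lemma dihmxE p k : dihmx (p, k) =
  (-1) ^+ k *: (rotmx (k%:R * t) *m (if p then matB R else 1%:M)).
Proof. by rewrite /dihmx /= matR_exp// scalemxAl. Qed.

(** Antiperiodicity and the reflection of the angle move every argument into the range
of the sign lemmas, with one exception at k = N - 1 treated below. *)
Lemma matA_dihmx_pos p k : (k < N)%N -> (p, k) <> (false, 0%N) ->
  let g := rotmx (k%:R * t) *m (if p then matB R else 1%:M) in
  forall v, C0 v -> pos4 (matW R N *m (g *m v)).
Proof.
move=> kN pk g v /cone0P[a0 [a1 [a2 [a3 [? ? ? ? ->]]]]].
suff [? ? ? ?] : [/\ pos4 (matW R N *m (g *m v0 R N)),
    pos4 (matW R N *m (g *m v1 R N)), pos4 (matW R N *m (g *m v2 R N))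
    & pos4 (matW R N *m (g *m v3 R N))].
  by rewrite !mulmxDr -!scalemxAr; do !apply: pos4D; apply: pos4Z.
have x1 : k%:R * t + t = k.+1%:R * t by rewrite -natr1; ring.
have x2 : k%:R * t + t + t = k.+2%:R * t by rewrite -!natr1; ring.
have pB (j : nat) : (j <= N)%N -> pi - j%:R * t = (N - j)%:R * t.
  by move=> jN; rewrite natrB// mulrBl Nt.
have kN' := ltnW kN.
have k2N : (k.+2 <= N.+1)%N by [].
have q0 := row1_v0_ge0 R hN kN'; have p0 := row1_v2_ge0 R hN (leqW kN').
have o0 := row3_v0_ge0 R hN kN'.
have e0 : 0 <= row1_v0 N (k%:R * t) + row1_v0 N (k%:R * t + t).
  by apply: addr_ge0 q0 _; rewrite x1; exact: row1_v0_ge0 kN.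
have p1 : 0 <= row1_v2 N (k%:R * t + t) by rewrite x1; exact: row1_v2_ge0 (leqW kN).
have e2 := addr_ge0 p0 p1.
have e3 : 0 <= row1_v2 N (k%:R * t + t) + row1_v2 N (k%:R * t + t + t).
  by apply: addr_ge0 p1 _; rewrite x2; exact: row1_v2_ge0 k2N.
have f1 : 0 <= row1_v1 N (pi - k%:R * t) by rewrite pB// row1_v1_ge0// subn_gt0 kN leq_subr.
have g1 : 0 <= row3_v1 N (pi - k%:R * t) by rewrite pB// row3_v1_ge0// leq_subr.
(* row1_v1 is negative at the angle 0, but it is compensated by its value at t:
   their sum is 0. *)
have row1_v1_0 : 0 <= row1_v1 N (0%:R * t) + row1_v1 N (1%:R * t).
  rewrite mul0r mul1r /row1_v1 !mulr0 sin0 cos0 !mulr0 !addr0 !mulr1.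
  have s0 := lt0r_neq0 (s_gt0 R hN); have h7 := u_ge R hN.
  rewrite cos3E sin3E sin_sq cot1u// cot2u//.
  set e := (X in 0 <= X).
  suff -> : e = 4 * (1 + L2 R N) * cos t * (1 - cos t) - (L2 R N - L1 R N)
     + (4 * (1 + L2 R N) * cos t * (1 - cos t) - (L2 R N - L1 R N)) * (cos t).
    by rewrite L_diff// subrr mul0r addr0.
  have h2 : 2 * cos t + 1 != 0 :> R by rewrite gt_eqF//; lra.
  by rewrite /e; field; rewrite s0 h2.
case: p @g pk => g pk.
  rewrite /g -!mulmxA W_Bv0// W_Bv1// W_Bv2// W_Bv3//.
  have f1' : 0 <= row1_v1 N (pi - (k%:R * t + t)) + row1_v1 N (pi - k%:R * t).
      rewrite x1 !pB//; have := kN; rewrite leq_eqVlt => /orP[/eqP E|kN1].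
      have -> : (N - k.+1 = 0)%N by rewrite E subnn.
      by have -> : (N - k = 1)%N by rewrite -E subSnn.
    by apply: addr_ge0; apply: row1_v1_ge0 => //; rewrite subn_gt0 leq_subr andbT ?kN1// ltnW.
  split.
  - exact: pos4_vec4 e0 q0 g1 o0.
  - exact: pos4_vec4 f1' f1 (row2_Bv1_ge0 R hN kN) g1.
  - exact: pos4_vec4 e2 p0 f1 q0.
  - exact: pos4_vec4 (addr_ge0 e2 e3) e2 f1' e0.
have k0 : (0 < k)%N by case: k pk {kN kN' x1 x2 k2N e0 e2 e3 f1 g1 g q0 p0 o0 p1}.
have x3 : k%:R * t - t = k.-1%:R * t by rewrite -[in LHS](prednK k0) -natr1; ring.
have km : (k.-1 <= N)%N by rewrite (leq_trans (leq_pred k)).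
have e2' : 0 <= row1_v2 N (k%:R * t - t) + row1_v2 N (k%:R * t).
  by apply: addr_ge0 p0; rewrite x3; exact: row1_v2_ge0 (leqW km).
have e0' : 0 <= row1_v0 N (k%:R * t - t) + row1_v0 N (k%:R * t).
  by apply: addr_ge0 q0; rewrite x3; exact: row1_v0_ge0 km.
have fa : 0 <= row1_v1 N (k%:R * t) by apply: row1_v1_ge0; rewrite ?k0.
have fb : 0 <= row1_v1 N (k%:R * t + t) by rewrite x1; apply: row1_v1_ge0.
have fc : 0 <= row1_v1 N (pi - (k%:R * t - t)).
  by rewrite x3 pB//; apply: row1_v1_ge0 => //; rewrite leq_subr subn_gt0 prednK ?kN'.
rewrite /g !mulmx1 W_v0// W_v1// W_v2// W_v3//; split.
- exact: pos4_vec4 e0 q0 g1 o0.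
- exact: pos4_vec4 (addr_ge0 fa fb) fa (row2_v1_ge0 R hN kN') (row3_v1_ge0 R hN kN').
- exact: pos4_vec4 e2 p0 f1 q0.
- exact: pos4_vec4 (addr_ge0 e2' e2) e2' (addr_ge0 f1 fc) e0'.
Qed.

Lemma matA_dihmx_cone d v : (d.2 < N)%N -> d <> (false, 0%N) -> C0 v ->
  exists2 w, C0 w & matA R N *m (dihmx d *m v) = (-1) ^+ d.2 *: w.
Proof.
case: d => p k /= kN pk Cv.
set g := rotmx (k%:R * t) *m (if p then matB R else 1%:M).
exists (matA R N *m (g *m v)); last by rewrite dihmxE -scalemxAl -scalemxAr.
have L0 := L_lt R hN.
have -> : matA R N *m (g *m v) =
    matV R N *m ((L2 R N - L1 R N)^-1 *: (matW R N *m (g *m v))).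
  rewrite -scalemxAr [X in _ = _ *: X]mulmxA matVW// -scalemxAl scalerA mulVf ?scale1r//.
  by rewrite gt_eqF.
apply: pos4_cone => i; rewrite mxE mulr_ge0 ?invr_ge0 ?(ltW L0)//.
exact: matA_dihmx_pos.
Qed.

End Dihedral.

(** * Composition in the dihedral group, and overlaps of cones *)

(** Equality in projective space, for vectors and for matrices alike. *)
Definition propor (R : pzRingType) (n m : nat) (M M' : 'M[R]_(n, m)) : Prop :=
  exists2 c : R, c != 0 & M = c *: M'.

Section Propor.
Variables (R : fieldType).

Lemma propor_refl n m (M : 'M[R]_(n, m)) : propor M M.
Proof. by exists 1; rewrite ?oner_neq0 ?scale1r. Qed.

Lemma propor_sym n m (M M' : 'M[R]_(n, m)) : propor M M' -> propor M' M.
Proof.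
by case=> c c0 ->; exists c^-1; rewrite ?invr_neq0// scalerA mulVf// scale1r.
Qed.

Lemma propor_trans n m (M M' M'' : 'M[R]_(n, m)) :
  propor M M' -> propor M' M'' -> propor M M''.
Proof.
by case=> c c0 -> [c' c'0 ->]; exists (c * c'); rewrite ?mulf_neq0 ?scalerA.
Qed.

Lemma propor_mul n m p (M M' : 'M[R]_(n, m)) (P P' : 'M[R]_(m, p)) :
  propor M M' -> propor P P' -> propor (M *m P) (M' *m P').
Proof.
case=> c c0 -> [c' c'0 ->]; exists (c * c'); rewrite ?mulf_neq0//.
by rewrite -scalemxAl -scalemxAr scalerA.
Qed.

Lemma propor_sign n m k (M M' : 'M[R]_(n, m)) :
  M = (-1) ^+ k *: M' -> propor M M'.
Proof. by move=> ->; exists ((-1) ^+ k); rewrite ?signr_eq0. Qed.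

End Propor.

(** The group law of the dihedral group on the pairs (p, k) standing for R^k B^p, from
B R = R^-1 B and R^N = 1 up to sign; the representative k < N is kept. *)
Definition dihmul (N : nat) (d e : bool * nat) : bool * nat :=
  (d.1 (+) e.1, (d.2 + (if d.1 then N - e.2 else e.2)) %% N)%N.

Definition dihinv (N : nat) (d : bool * nat) : bool * nat :=
  (d.1, if d.1 then d.2 else (N - d.2) %% N)%N.

Lemma dihmul_modn N k m : (k < N)%N -> (m < N)%N ->
  ((k + (N - (k + (N - m)) %% N)) %% N = m)%N.
Proof.
move=> kN mN; have [km|mk] := ltnP k m.
  rewrite (@modn_small (k + (N - m))); last by lia.
  by have -> : (k + (N - (k + (N - m))) = m)%N by [lia]; rewrite modn_small.
have -> : (k + (N - m) = k - m + N)%N by lia.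
rewrite modnDr (@modn_small (k - m)); last by lia.
by have -> : (k + (N - (k - m)) = m + N)%N by [lia]; rewrite modnDr modn_small.
Qed.

Section Overlap.
Variables (R : realType) (N : nat).
Hypothesis hN : (4 <= N)%N.

Local Notation t := (pi / N%:R : R).
Local Notation C0 := (@cone0 R N).
Local Notation dihmx := (dihmx R N).
Local Notation Bp p := (if p then matB R else 1%:M).

Lemma N_gt0 : (0 < N)%N. Proof. by case: N hN. Qed.

Lemma angleD a b : (a + b)%:R * t = a%:R * t + b%:R * t.
Proof. by rewrite natrD; ring. Qed.

Lemma angle_opp m : (m <= N)%N -> (N - m)%:R * t = pi - m%:R * t.
Proof. by move=> mN; rewrite natrB// mulrBl Nt. Qed.

Lemma rotmx_modn n : propor (rotmx (n%:R * t)) (rotmx ((n %% N)%:R * t)).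
Proof.
apply: (@propor_sign _ _ _ (n %/ N)); rewrite [in LHS](divn_eq n N).
elim: (n %/ N)%N => [|q IH]; first by rewrite add0n scale1r.
have -> : (q.+1 * N + n %% N)%:R * t = pi + (q * N + n %% N)%:R * t.
  by rewrite mulSn -addnA angleD Nt.
by rewrite rotmxD IH rotmx_pi mulNmx mul1mx exprS -scalerA scaleN1r.
Qed.

Lemma dihmx_rotmx p k : propor (dihmx (p, k)) (rotmx (k%:R * t) *m Bp p).
Proof. exact: propor_sign (dihmxE R hN p k). Qed.

Lemma dihmx_mul d e : (e.2 < N)%N -> propor (dihmx d *m dihmx e) (dihmx (dihmul N d e)).
Proof.
case: d e => p k [q m] /= mN; rewrite /dihmul /=.
apply: (propor_trans _ (propor_sym (dihmx_rotmx _ _))).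
apply: (propor_trans _ (propor_mul (rotmx_modn _) (propor_refl _))).
apply: propor_trans (propor_mul (dihmx_rotmx p k) (dihmx_rotmx q m)) _.
rewrite mulmxA; case: p => /=; last first.
  by rewrite mulmx1 -rotmxD angleD; exact: propor_refl.
have B2 (b : bool) : matB R *m Bp b = Bp (~~ b).
  by case: b; rewrite ?mulmx1 ?matB_sq.
rewrite -(mulmxA _ (matB R)) matB_rotmx -!mulmxA B2 mulmxA -rotmxD.
apply: propor_mul; last exact: propor_refl.
apply: (@propor_sign _ _ _ 1).
rewrite expr1 scaleN1r angleD angle_opp ?(ltnW mN)//.
have -> : k%:R * t + (pi - m%:R * t) = pi + (k%:R * t - m%:R * t) by ring.
by rewrite [in RHS]rotmxD rotmx_pi mulNmx mul1mx opprK.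
Qed.

Lemma dihmul_lt d e : ((dihmul N d e).2 < N)%N.
Proof. by rewrite ltn_mod N_gt0. Qed.

Lemma dihmulr1 d : (d.2 < N)%N -> dihmul N d (false, 0%N) = d.
Proof.
case: d => [[] k] /= kN; rewrite /dihmul /= ?subn0 ?addn0 ?modnDr.
  by rewrite modn_small.
by rewrite modn_small.
Qed.

Lemma dihmulKV d e : (d.2 < N)%N -> (e.2 < N)%N ->
  dihmul N d (dihmul N (dihinv N d) e) = e.
Proof.
case: d e => [[] k] [p m] /= kN mN; rewrite /dihmul /dihinv /= ?negbK; congr (_, _).
  exact: dihmul_modn.
rewrite modnDmr addnCA modnDml.
have -> : (N - k + (k + m) = m + N)%N by lia.
by rewrite modnDr modn_small.
Qed.

(** The quotient d^-1 e, which brings two cones to the position of C0 and a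
translate of it. *)
Lemma dihmx_quotient d e : (d.2 < N)%N -> (e.2 < N)%N -> d <> e ->
  exists f, [/\ (f.2 < N)%N, f <> (false, 0%N) & propor (dihmx e) (dihmx d *m dihmx f)].
Proof.
move=> dN eN de; exists (dihmul N (dihinv N d) e); split; first exact: dihmul_lt.
  by move=> E; apply: de; rewrite -(dihmulKV dN eN) E dihmulr1.
by apply: propor_sym; rewrite -{2}(dihmulKV dN eN); apply: dihmx_mul; exact: dihmul_lt.
Qed.

(** Let v = c R^m B^q w. Then sin t times phi_im or phi_wall at v is a combination of
- phi_im and phi_wall at w, both nonnegative, with coefficients sin(j t) for two
consecutive integers j close to 2 m. If these angles are at most pi,
phi_im v >= 0, and if they are between pi and 2 pi, phi_wall v <= 0; in either
case the opposite inequality holds because v is in C0. *)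
Lemma cone_overlap d v w : (d.2 < N)%N -> d <> (false, 0%N) -> C0 v -> C0 w ->
  propor v (dihmx d *m w) -> phi_im N v v * phi_wall N v v = 0.
Proof.
case: d => q m /= mN d0 Cv Cw vw.
have {vw} [c c0 vE] : propor v (rotmx (m%:R * t) *m (Bp q *m w)).
  apply: propor_trans vw _; rewrite mulmxA.
  exact: propor_mul (dihmx_rotmx _ _) (propor_refl _).
have s0 := s_gt0 R hN.
have Iw := phi_im_cone hN Cw; have Kw := phi_wall_cone hN Cw.
have Iv := phi_im_cone hN Cv; have Kv := phi_wall_cone hN Cv.
have c2 : 0 <= c ^+ 2 by exact: sqr_ge0.
have kE x : phi_wall N x x = cos t * phi_im N x x - sin t * phi_re N x x by [].
have I_0 a b : sin t * phi_im N v v = c ^+ 2 * (- phi_im N w w * a + phi_wall N w w * b) ->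
    0 <= a -> 0 <= b -> phi_im N v v * phi_wall N v v = 0.
  move=> E a0 b0; have : 0 <= sin t * phi_im N v v.
    by rewrite E mulr_ge0// addr_ge0// mulr_ge0// oppr_ge0.
  rewrite pmulr_rge0// => I0.
  by have -> : phi_im N v v = 0; [apply/eqP; rewrite eq_le Iv I0 | rewrite mul0r].
have K_0 a b : sin t * phi_wall N v v = c ^+ 2 * (- phi_im N w w * a + phi_wall N w w * b) ->
    a <= 0 -> b <= 0 -> phi_im N v v * phi_wall N v v = 0.
  move=> E a0 b0; have : sin t * phi_wall N v v <= 0.
    rewrite E mulr_ge0_le0// -[leRHS]addr0 lerD// mulr_ge0_le0//.
    by rewrite oppr_ge0.
  rewrite pmulr_rle0// => K0.
  by have -> : phi_wall N v v = 0; [apply/eqP; rewrite eq_le Kv K0 | rewrite mulr0].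
have x0 : (2 * m)%:R * t = 2 * (m%:R * t) by rewrite natrM; ring.
have x1 : (2 * m).+1%:R * t = 2 * (m%:R * t) + t by rewrite -addn1 angleD x0 mul1r.
have x2 : (2 * m).+2%:R * t = 2 * (m%:R * t) + t + t.
  by rewrite -addn1 angleD x1 mul1r.
have m2N : ((2 * m).+2 <= 2 * N)%N by rewrite !mul2n -doubleS leq_double.
case: q d0 vE => d0 vE.
  have [mN2|mN2] := leqP (2 * m).+1 N.
    apply: (I_0 (sin ((2 * m).+1%:R * t)) (sin ((2 * m)%:R * t))).
    - by rewrite x0 x1 vE phi_imZ phi_im_rotmx phi_im_B phi_re_B kE !sinD; ring.
    - exact: sin_angle_ge0.
    - by apply: sin_angle_ge0 => //; exact: ltnW.
  apply: (K_0 (sin ((2 * m).+2%:R * t)) (sin ((2 * m).+1%:R * t))).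
  - rewrite x1 x2 kE vE phi_imZ phi_reZ phi_im_rotmx phi_re_rotmx phi_im_B phi_re_B kE.
    by rewrite !(sinD, cosD); ring.
  - by apply: sin_angle_le0 => //; rewrite m2N andbT ltnW// ltnW.
  - by apply: sin_angle_le0 => //; rewrite (ltnW m2N) andbT ltnW.
have m0 : (0 < 2 * m)%N by rewrite muln_gt0; case: m d0 {mN vE x0 x1 x2 m2N}.
have x3 : (2 * m).-1%:R * t = 2 * (m%:R * t) - t.
  by rewrite -x0 -[in RHS](prednK m0) -natr1; ring.
rewrite mul1mx in vE.
have [mN2|mN2] := leqP (2 * m) N.
  apply: (I_0 (sin ((2 * m).-1%:R * t)) (sin ((2 * m)%:R * t))).
  - by rewrite x0 x3 vE phi_imZ phi_im_rotmx kE !sinB; ring.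
  - by apply: sin_angle_ge0 => //; rewrite (leq_trans (leq_pred _)).
  - exact: sin_angle_ge0.
apply: (K_0 (sin ((2 * m)%:R * t)) (sin ((2 * m).+1%:R * t))).
- rewrite x0 x1 kE vE phi_imZ phi_reZ phi_im_rotmx phi_re_rotmx kE.
  by rewrite !(sinD, cosD); have us := sin_sq R N; ring: us.
- by apply: sin_angle_le0 => //; rewrite (ltnW mN2) (ltnW (ltnW m2N)).
- by apply: sin_angle_le0 => //; rewrite (ltnW m2N) andbT ltnW// ltnW.
Qed.

End Overlap.

(** * Interiors in projective space *)

(** Along the line x + e w the product is a polynomial in e of degree 4 with nonzero
leading coefficient, while an open set contains infinitely many points of the
line near x. *)
Lemma quadratic_prod_neq0 (R : realType) (O : set 'cV[R]_4) (x w : 'cV[R]_4)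
    (f g : 'cV[R]_4 -> R) (a b : 'I_3 -> R) :
  open O -> O x ->
  (forall e, f (x + e *: w) = a 0 + a 1 * e + a 2 * e ^+ 2) ->
  (forall e, g (x + e *: w) = b 0 + b 1 * e + b 2 * e ^+ 2) ->
  a 2 != 0 -> b 2 != 0 ->
  exists2 y, O y & f y * g y != 0.
Proof.
move=> oO Ox fE gE a2 b2.
have [d d0 dO] : exists2 d : R, 0 < d & forall e, `|e| < d -> O (x + e *: w).
  have ct : {for 0, continuous (fun e : R => x + e *: w)}.
    by apply: cvgD; [exact: cvg_cst|exact: scalel_continuous].
  have := ct O; rewrite /= scale0r addr0 => /(_ (open_nbhs_nbhs (conj oO Ox))).
  case/nbhs_ballP => d /= d0 dO; exists d => // e ed; apply: dO.
  by rewrite /ball /= sub0r normrN.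
pose P (c : 'I_3 -> R) := Poly [:: c 0; c 1; c 2].
have PE c e : (P c).[e] = c 0 + c 1 * e + c 2 * e ^+ 2.
  by rewrite horner_Poly /=; ring.
have P0 c : c 2 != 0 -> P c != 0.
  move=> c2; apply/eqP => /(congr1 (fun p : {poly R} => p`_2)).
  by rewrite coef_Poly coef0 /= => /eqP; rewrite (negbTE c2).
have Psize c : (size (P c) <= 3)%N by exact: size_Poly.
pose rs := [seq d / 2 / i.+1%:R | i <- iota 0 5].
apply: contrapT => no.
have : (size rs < size (P a * P b)%R)%N.
  apply: max_poly_roots; first by rewrite mulf_neq0 ?P0.
    apply/allP => e /mapP[i _ ->]; rewrite /root hornerM !PE -fE -gE.
    apply: contrapT => /negP fg0; apply: no.
    exists (x + d / 2 / i.+1%:R *: w) => //; apply: dO.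
    rewrite ger0_norm ?divr_ge0 ?(ltW d0)//.
    rewrite ltr_pdivrMr ?ltr0n// -[i.+1%:R]natr1.
    have : 0 <= d * i%:R by rewrite mulr_ge0 ?(ltW d0).
    by lra.
  rewrite map_inj_uniq ?iota_uniq// => i j.
  have d2 : d / 2 != 0 by rewrite mulf_neq0 ?invr_eq0 ?gt_eqF.
  by move/(mulfI d2)/invr_inj/eqP; rewrite eqr_nat => /eqP[].
rewrite size_map size_iota ltnNge => /negP; apply.
apply: leq_trans (size_mul_leq _ _) _.
have := leq_add (Psize a) (Psize b); case: (_ + _)%N => // n.
Qed.

Definition nzvec_of (R : realType) (n : nat) (v : 'cV[R]_n) (v0 : v != 0) :
  nzvec R n := @exist 'cV[R]_n (fun w => w \in [set v | v != 0]) v (mem_set v0).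

Section Top.
Variables (R : realType) (N : nat).
Hypothesis hN : (4 <= N)%N.

Local Notation C0 := (@cone0 R N).
Local Notation dihmx := (dihmx R N).

Lemma dihmx_unit d : (d.2 < N)%N -> dihmx d \in unitmx.
Proof.
move=> dN; rewrite /dihmx unitmx_mul; apply/andP; split.
  rewrite -[matR R N ^+ d.2]mulr1 -mulmxE.
  elim: d.2 => [|n IH]; first by rewrite expr0 mulmx1 unitmx1.
  move: IH; rewrite !mulmxE !mulr1 exprS -mulmxE unitmx_mul => ->; rewrite andbT.
  rewrite unitmx_mul; apply/andP; split.
    by case: (mulmx1_unit (matB_sq R)).
  by case: (mulmx1_unit (matC_sq R N)).
by case: d.1; [case: (mulmx1_unit (matB_sq R))|rewrite unitmx1].
Qed.

Lemma proj_coneP p k (v : nzvec R 4) :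
  proj_cone R N p k (\pi_(Defs.proj R 4) v)%qT <->
  exists2 w, C0 w & propor (val v) (dihmx (p, k) *m w).
Proof.
rewrite /proj_cone /proj_img simplicial_coneE; split.
  case=> w [w' Cw' E] /proj_piP[c c0 wv]; exists w' => //.
  by exists c => //; rewrite wv E.
case=> w Cw [c c0 E].
have w0 : dihmx (p, k) *m w != 0.
  apply/eqP => w0; have /set_mem /= := valP v.
  by rewrite E w0 scaler0 eqxx.
exists (nzvec_of w0); first by exists w.
by apply/proj_piP; exists c.
Qed.

(** On the common part of the two cones the product of the two forms, pulled back by
d^-1, vanishes by cone_overlap; the direction in which this is contradicted is
the image of a point of C0 off both mirrors. *)
Lemma proj_cone_interior_disjoint (d e : bool * nat) :
  (d.2 < N)%N -> (e.2 < N)%N -> d <> e ->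
  (proj_cone R N d.1 d.2)° `&` (proj_cone R N e.1 e.2)° = set0.
Proof.
move=> dN eN de; apply/seteqP; split=> // x xU.
have [f [fN f0 ef]] := dihmx_quotient R hN dN eN de.
have oU : open ((\pi_(Defs.proj R 4))%qT @^-1`
    ((proj_cone R N d.1 d.2)° `&` (proj_cone R N e.1 e.2)°)).
  have o : open ((proj_cone R N d.1 d.2)° `&` (proj_cone R N e.1 e.2)°).
    by apply: openI; exact: open_interior.
  exact: o.
have [W oW WU] : exists2 W : set 'cV[R]_4, open W & set_val @^-1` W =
   (\pi_(Defs.proj R 4))%qT @^-1`
    ((proj_cone R N d.1 d.2)° `&` (proj_cone R N e.1 e.2)°).
  by case: oU => W oW E; exists W.
have [v0 [Cv0 I0 K0]] := cone_interior R hN.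
pose g := invmx (dihmx d).
have gd (w : 'cV[R]_4) : g *m (dihmx d *m w) = w.
  by rewrite mulmxA mulVmx ?mul1mx// dihmx_unit.
pose F (y : 'cV[R]_4) := phi_im N (g *m y) (g *m y).
pose G (y : 'cV[R]_4) := phi_wall N (g *m y) (g *m y).
have FG y : W y -> F y * G y = 0.
  move=> Wy; have [->|y0] := eqVneq y 0.
    by rewrite /F mulmx0 /phi_im !mxE; ring.
  pose yn := nzvec_of y0.
  have : (set_val @^-1` W) yn by [].
  rewrite WU => -[/interior_subset/proj_coneP[v Cv yv]
                  /interior_subset/proj_coneP[w Cw yw]].
  have vw : propor v (dihmx f *m w).
    rewrite -(gd v) -(gd (dihmx f *m w)); apply: propor_mul (propor_refl _) _.
    apply: propor_trans (propor_sym yv) _; apply: propor_trans yw _.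
    rewrite -!surjective_pairing mulmxA.
    exact: propor_mul ef (propor_refl _).
  have [c c0 yc] := yv.
  rewrite /F /G [y]yc -surjective_pairing -scalemxAr gd phi_imZ phi_wallZ mulrACA.
  by rewrite (cone_overlap hN fN f0 Cv Cw vw) mulr0.
elim/quotW: x xU => x xU.
have Wx : W (val x) by have : (set_val @^-1` W) x by rewrite WU.
pose w := dihmx d *m v0.
pose a (i : 'I_3) := nth 0 [:: F (val x); 2 * phi_im N (g *m val x) v0; phi_im N v0 v0] i.
pose b (i : 'I_3) := nth 0 [:: G (val x); 2 * phi_wall N (g *m val x) v0; phi_wall N v0 v0] i.
have [] := @quadratic_prod_neq0 R W (val x) w F G a b oW Wx.
- move=> ep; rewrite /a /= /F mulmxDr -scalemxAr gd.
  by move: (g *m _) v0 {w a b I0 K0 Cv0} => y v0; rewrite /phi_im !mxE; ring.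
- move=> ep; rewrite /b /= /G mulmxDr -scalemxAr gd.
  by move: (g *m _) v0 {w a b I0 K0 Cv0} => y v0; rewrite /phi_wall /phi_im /phi_re !mxE; ring.
- exact: I0.
- exact: K0.
by move=> y Wy; rewrite FG// eqxx.
Qed.

Lemma proj_cone_gspA p k : (k < N)%N -> (p, k) <> (false, 0%N) ->
  [set proj_act (gspA R N) x | x in proj_cone R N p k]
    `<=` proj_cone R N false 0.
Proof.
move=> kN pk _ [x xC <-]; elim/quotW: x xC => x /proj_coneP[v Cv xv].
rewrite proj_actE; apply/proj_coneP.
have [w Cw Aw] := @matA_dihmx_cone R N hN (p, k) v kN pk Cv.
exists w => //; rewrite /dihmx /= expr0 !mul1mx.
apply: propor_trans (propor_mul (propor_refl _) xv) _.
exact: propor_sign Aw.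
Qed.

End Top.

(** * Normal forms in the abstract group *)

(** The pair (d, l) stands for the product d a e1 a e2 ... a en, where l lists the e_i;
all the e_i but the last must be nontrivial. *)
Fixpoint reduced (N : nat) (d : bool * nat) (l : seq (bool * nat)) : bool :=
  (d.2 < N)%N && if l is e :: l' then
    ((l' == [::]) || (e != (false, 0%N))) && reduced N e l' else true.

Section NormalForm.
Local Open Scope group_scope.
Variables (G : groupType) (N : nat) (xa xb xc : G).
Hypothesis N0 : (0 < N)%N.
Hypotheses (a2 : xa * xa = 1) (b2 : xb * xb = 1) (c2 : xc * xc = 1).
Hypothesis bcN : (xb * xc) ^+ N = 1.

Definition dihg (d : bool * nat) : G := (xb * xc) ^+ d.2 * (if d.1 then xb else 1).

Fixpoint nf (d : bool * nat) (l : seq (bool * nat)) : G :=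
  if l is e :: l' then dihg d * (xa * nf e l') else dihg d.

Lemma expg_modn (x : G) n : x ^+ N = 1 -> x ^+ (n %% N) = x ^+ n.
Proof.
move=> xN; rewrite [in RHS](divn_eq n N) mulnC expgnDr expgnA xN expg1n.
by rewrite mul1g.
Qed.

Lemma dihg_r d : (xb * xc) * dihg d = dihg (d.1, (d.2.+1 %% N)%N).
Proof. by rewrite /dihg /= expg_modn// mulgA -expgS. Qed.

(** The inverse of xb xc is xc xb, so xb (xb xc)^k = (xb xc)^(N - k) xb. *)
Lemma dihg_b d : (d.2 < N)%N -> xb * dihg d = dihg (dihmul N (true, 0%N) d).
Proof.
case: d => p k /= kN; rewrite /dihg /dihmul /= add0n expg_modn//.
have rb : xb * (xb * xc) ^+ k = (xb * xc) ^+ (N - k) * xb.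
  have cb : (xb * xc)^-1 = xc * xb.
    by apply: mulg1_eq; rewrite mulgA -(mulgA xb) c2 mulg1.
  rewrite expgnFr ?bcN ?(ltnW kN)// mul1g -expVgn cb.
  elim: k {kN} => [|k IH]; first by rewrite !expg0 mulg1 mul1g.
  by rewrite !expgS mulgA (mulgA xb) b2 mul1g -!mulgA -IH (mulgA xb xb) b2 mul1g.
by rewrite mulgA rb -mulgA; case: p; rewrite /= ?b2 ?mulg1.
Qed.

Definition has_nf (x : G) := exists d l, reduced N d l /\ x = nf d l.

Lemma nf_dihg d d' l z : reduced N d l -> (d'.2 < N)%N -> z * dihg d = dihg d' ->
  has_nf (z * nf d l).
Proof.
move=> rl d'N zd; exists d', l; split; last by case: l rl => [|e l] _ /=; rewrite -zd -?mulgA.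
by case: l rl => [|e l] /= /andP[_ rl]; rewrite d'N.
Qed.

Lemma has_nf_b x : has_nf x -> has_nf (xb * x).
Proof.
case=> d [l [rl ->]]; have dN : (d.2 < N)%N by case: l rl => [|e l] /andP[].
by apply: nf_dihg rl _ (dihg_b dN); rewrite ltn_mod.
Qed.

(** xc is xb times the rotation xb xc. *)
Lemma has_nf_c x : has_nf x -> has_nf (xc * x).
Proof.
move=> hx; have -> : xc * x = xb * ((xb * xc) * x).
  by rewrite !mulgA b2 mul1g.
apply: has_nf_b; case: hx => d [l [rl ->]].
by apply: nf_dihg rl _ (dihg_r d); rewrite ltn_mod.
Qed.

(** If the product already starts with xa, the two letters cancel; otherwise its first
dihedral factor is nontrivial and may become an inner one. *)
Lemma has_nf_a x : has_nf x -> has_nf (xa * x).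
Proof.
case=> d [l [rl ->]]; case: l rl => [|e l] rl.
  by exists (false, 0%N), [:: d]; split; rewrite /= ?N0//= /dihg /= expg0 !mul1g.
have [d1|d1] := eqVneq d (false, 0%N).
  exists e, l; split; first by move: rl => /= /and3P[].
  by rewrite d1 /= /dihg /= expg0 !mul1g mulgA a2 mul1g.
exists (false, 0%N), (d :: e :: l); split.
  by rewrite [reduced _ _ _]/= N0 d1 -/(reduced N d (e :: l)).
by rewrite /= {2}/dihg /= expg0 !mul1g.
Qed.

End NormalForm.

(** * Ping-pong *)

Section PingPong.
Variables (R : realType) (N : nat).
Hypothesis hN : (4 <= N)%N.

Local Notation C0 := (@cone0 R N).
Local Notation dihmx := (dihmx R N).

Fixpoint nfmx (d : bool * nat) (l : seq (bool * nat)) : 'M[R]_4 :=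
  if l is e :: l' then dihmx d *m (matA R N *m nfmx e l') else dihmx d.

(** Reading the product from the right: the rightmost dihedral factor times e moves C0
to another cone, A brings it into C0, the next factor is nontrivial, and so on. *)
Lemma nfmx_cone d l e v : reduced N d l -> l != [::] -> (e.2 < N)%N ->
  dihmul N (last d l) e <> (false, 0%N) -> C0 v ->
  exists2 w, C0 w & propor (nfmx d l *m (dihmx e *m v)) (dihmx d *m w).
Proof.
move=> + + eN + Cv.
have [n ln] := ubnP (size l); elim: n => // n IH in d l ln *.
case: l ln => // f l ln rl _ ne.
rewrite /= -(mulmxA (dihmx d)) -(mulmxA (matA R N)).
suff [w Cw Aw] : exists2 w, C0 w & propor (matA R N *m (nfmx f l *m (dihmx e *m v))) w.
  by exists w => //; apply: propor_mul (propor_refl _) Aw.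
have fN : (f.2 < N)%N by move: rl => /= /and3P[_ _]; case: l {ln ne} => [|? ?] /andP[].
case: l ln rl ne => [|f' l] ln rl ne.
  have [w Cw Aw] := matA_dihmx_cone hN (dihmul_lt hN f e) ne Cv.
  exists w => //; apply: propor_trans _ (propor_sign Aw).
  apply: propor_mul (propor_refl _) _; rewrite mulmxA.
  exact: propor_mul (dihmx_mul R hN f eN) (propor_refl _).
move: rl => /= /and3P[_ /= /eqP f1 rl].
have [w Cw Aw] := IH f (f' :: l) ln rl isT ne.
have [w' Cw' Aw'] := matA_dihmx_cone hN fN f1 Cw.
exists w' => //; apply: propor_trans _ (propor_sign Aw').
exact: propor_mul (propor_refl _) Aw.
Qed.

Lemma cone_not_into d e : (d.2 < N)%N -> (e.2 < N)%N -> d <> e ->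
  ~ (forall v, C0 v -> exists2 w, C0 w & propor (dihmx e *m v) (dihmx d *m w)).
Proof.
move=> dN eN de H; have [v [Cv I0 K0]] := cone_interior R hN.
have [w Cw vw] := H v Cv.
have [f [fN f0 ef]] := dihmx_quotient R hN eN dN (nesym de).
have vfw : propor v (dihmx f *m w).
  have g (y : 'cV[R]_4) : invmx (dihmx e) *m (dihmx e *m y) = y.
    by rewrite mulmxA mulVmx ?mul1mx// dihmx_unit.
  rewrite -(g v) -(g (dihmx f *m w)); apply: propor_mul (propor_refl _) _.
  apply: propor_trans vw _; rewrite mulmxA.
  exact: propor_mul ef (propor_refl _).
by have /eqP := cone_overlap hN fN f0 Cv Cw vfw; rewrite mulf_eq0 (negbTE I0) (negbTE K0).
Qed.

(** Each of the two conditions excludes one element, so one of the three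
rotations 1, R, R^2 satisfies both. *)
Lemma avoid_two d f : exists e,
  [/\ (e.2 < N)%N, d <> e & dihmul N f e <> (false, 0%N)].
Proof.
case: f => [[] k].
  have [d0|/eqP d0] := eqVneq d (false, 0%N).
    by exists (false, 1%N); split; rewrite ?d0//=; lia.
  by exists (false, 0%N); split => //=; lia.
have H j : dihmul N (false, k) (false, j) <> (false, 0%N) \/ ((k + j) %% N = 0)%N.
  rewrite /dihmul /=; have [->|/eqP kj] := eqVneq ((k + j) %% N)%N 0%N; first by right.
  by left => -[].
have H2 i j : (i < j < 3)%N -> ((k + i) %% N = 0)%N -> ((k + j) %% N = 0)%N -> False.
  case/andP=> ij j3 i0 j0.
  have : ((k + j) %% N = (k + i + (j - i)) %% N)%N by congr modn; lia.
  by rewrite -[RHS]modnDml i0 j0 add0n modn_small; lia.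
have H3 i j : i != j -> (false, i) <> (false, j) by move=> /eqP ij [].
have good j : (j < 3)%N -> d <> (false, j) -> ((k + j) %% N)%N <> 0%N ->
    exists e, [/\ (e.2 < N)%N, d <> e & dihmul N (false, k) e <> (false, 0%N)].
  move=> j3 dj kj; exists (false, j); split => //=; first by lia.
  by rewrite /dihmul /= => -[].
have [d0|/eqP d0] := eqVneq d (false, 0%N).
  have [cot1|/eqP cot1] := eqVneq ((k + 1) %% N)%N 0%N.
    apply: (good 2%N) => //; first by rewrite d0.
    by move=> cot2; apply: (H2 1%N 2%N).
  by apply: (good 1%N) => //; rewrite d0.
have [k0|/eqP k0] := eqVneq ((k + 0) %% N)%N 0%N; last exact: (good 0%N).
have [d1|/eqP d1] := eqVneq d (false, 1%N).
  apply: (good 2%N) => //; first by rewrite d1.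
  by move=> cot2; apply: (H2 0%N 2%N).
by apply: (good 1%N) => // cot1; apply: (H2 0%N 1%N).
Qed.

Lemma nfmx_scalar d l : reduced N d l -> propor (nfmx d l) 1%:M ->
  d = (false, 0%N) /\ l = [::].
Proof.
move=> rl g1; have dN : (d.2 < N)%N by case: l rl {g1} => [|e l] /andP[].
have [l0|l0] := eqVneq l [::].
  split=> //; apply: contrapT => d1.
  have N0 : (0 < N)%N by exact: N_gt0 hN.
  apply: (@cone_not_into d (false, 0%N)) => // v Cv; exists v => //.
  rewrite l0 /= in g1.
  apply: (propor_trans _ (propor_mul (propor_sym g1) (propor_refl _))).
  by rewrite /dihmx /= expr0 !mul1mx; exact: propor_refl.
have [e [eN de ne]] := avoid_two d (last d l).
exfalso; apply: (cone_not_into dN eN de) => v Cv.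
have [w Cw gw] := nfmx_cone rl l0 eN ne Cv.
exists w => //; apply: propor_trans _ gw.
rewrite -[X in propor X _]mul1mx.
exact: propor_mul (propor_sym g1) (propor_refl _).
Qed.

End PingPong.

(** * The isomorphism *)

Section Presentation.
Variables (T : choiceType) (rels : set (word T)).
Local Notation G := (presented rels).

Lemma pi_cat (u v : word T) :
  (\pi_G (u ++ v) = (\pi_G u : G) * (\pi_G v : G))%qT%g.
Proof.
apply/pres_piP; apply: pres_cat; apply: pres_sym; exact: pres_repr.
Qed.

(** For an involution the formal inverse of a letter may be replaced by the letter. *)
Lemma pres_letter_sign (x : T) (b : bool) :
  pres_eqv rels [:: (x, false); (x, false)] [::] ->
  pres_eqv rels [:: (x, b)] [:: (x, false)].
Proof.
case: b => xx; last exact: pres_refl.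
have xi := pres_cancel rels x true.
apply: (pres_trans (v := [:: (x, true)] ++ [:: (x, false); (x, false)])).
  apply: pres_sym; rewrite -[X in pres_eqv _ _ X]cats0.
  exact: pres_cat (pres_refl _ _) xx.
exact: (pres_cat (u := [:: (x, true); (x, false)]) (u' := [::]) xi (pres_refl _ _)).
Qed.

End Presentation.

Section Hom.
Variables (R : realType) (N : nat).
Hypothesis hN : (4 <= N)%N.

Local Notation J := (matJ R N).
Local Notation rels := (coxeter_rels N).
Local Notation G := (presented rels).
Local Notation dihmx := (dihmx R N).

Definition gen (i : 'I_3) : gsp J :=
  if i == 0 then gspA R N else if i == 1 then gspB R N else gspC R N.

(** The generators being involutions, formal inverses are evaluated like the letters. *)
Definition ev (w : word 'I_3) : gsp J := foldr (fun l g => (gen l.1 * g)%g) 1%g w.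

Lemma gen_sq i : (gen i * gen i = 1)%g.
Proof.
apply: val_inj; rewrite /gen.
case: ifP => _; first exact: matA_sq.
by case: ifP => _; [exact: matB_sq | exact: matC_sq].
Qed.

Lemma ev_cat u v : ev (u ++ v) = (ev u * ev v)%g.
Proof. by elim: u => [|l u IH] /=; rewrite ?mul1g// IH mulgA. Qed.

Lemma ev_pow u n : ev (word_pow u n) = (ev u ^+ n)%g.
Proof. by elim: n => [|n IH] //; rewrite /word_pow /= ev_cat expgS -IH. Qed.

Lemma gsp_valM (g h : gsp J) : gsp_val (g * h)%g = gsp_val g *m gsp_val h.
Proof. by []. Qed.

Lemma ev_eqv u v : pres_eqv rels u v -> propor (gsp_val (ev u)) (gsp_val (ev v)).
Proof.
elim=> {u v} [u|u v _|u v w _ + _|u u' v v' _ + _|x b|r rr].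
- exact: propor_refl.
- exact: propor_sym.
- exact: propor_trans.
- by rewrite !ev_cat !gsp_valM; exact: propor_mul.
- have -> : ev [:: (x, b); (x, ~~ b)] = 1%g by rewrite /ev /= mulg1 gen_sq.
  exact: propor_refl.
have sq i : propor (gsp_val (ev (word_pow (letter i) 2))) 1%:M.
  have -> : ev (word_pow (letter i) 2) = 1%g.
    by rewrite ev_pow expg2 /= mulg1 gen_sq.
  exact: propor_refl.
case: rr => [[[|]|]|] ->; [exact: sq|exact: sq|exact: sq|].
rewrite ev_pow.
have E n : gsp_val (ev (letter (1%R : 'I_3) ++ letter (2%R : 'I_3)) ^+ n)%g = matR R N ^+ n.
  elim: n => [|n IH] //; rewrite expgS exprS gsp_valM IH -mulmxE; congr (_ *m _).
  by rewrite /ev /= mulmx1.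
apply: (@propor_sign _ _ _ N.+1); apply: etrans (E N) _; rewrite matR_exp// Nt// rotmx_pi exprSr.
by rewrite mulrN1 scaleNr scalerN.
Qed.

(** A matrix representing x up to a scalar: independent of the word chosen for x by
ev_eqv, and compatible with products by repM. *)
Definition rep (x : G) (M : 'M[R]_4) := propor (gsp_val (ev (repr x))) M.

Lemma rep_pi w : rep (\pi_G w)%qT (gsp_val (ev w)).
Proof. exact: ev_eqv (pres_repr _ _). Qed.

Lemma repM x y M P : rep x M -> rep y P -> rep (x * y)%g (M *m P).
Proof.
move=> xM yP; apply: propor_trans (rep_pi _) _.
by rewrite ev_cat gsp_valM; exact: propor_mul.
Qed.

Lemma rep1 : rep 1%g 1%:M.
Proof. exact: rep_pi [::]. Qed.

Definition xg (i : 'I_3) : G := (\pi_G (letter i))%qT.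

Lemma rep_xg i : rep (xg i) (gsp_val (gen i)).
Proof. by apply: propor_trans (rep_pi _) _; rewrite /= mulmx1; exact: propor_refl. Qed.

Lemma xg_pow_rel u n : rels (word_pow u n) -> ((\pi_G u : G) ^+ n = 1 :> G)%qT%g.
Proof.
move=> un; transitivity (\pi_G (word_pow u n) : G)%qT.
  by elim: n {un} => [|n IH] //; rewrite expgS IH -pi_cat.
by apply/pres_piP; exact: pres_rel.
Qed.

Lemma xg_sq i : (xg i * xg i = 1 :> G)%g.
Proof.
rewrite -expg2; apply: xg_pow_rel.
by case: i => [[|[|[|//]]] i3]; [left; left; left|left; left; right|left; right];
  congr (word_pow (letter _) 2); apply: val_inj.
Qed.

Lemma xg_bcN : ((xg 1%R * xg 2%R) ^+ N = 1 :> G)%g.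
Proof. by rewrite -pi_cat; apply: xg_pow_rel; right. Qed.

Lemma has_nf_presented (x : G) : has_nf N (xg 0) (xg 1) (xg 2) x.
Proof.
have N0 := N_gt0 hN.
rewrite -[x]reprK; elim: (repr x) => [|[i b] w IH].
  exists (false, 0%N), [::]; split; rewrite /= ?N0//.
  by rewrite /dihg /= expg0 mulg1.
have -> : (\pi_G ((i, b) :: w) : G)%qT = (xg i * \pi_G w)%qT%g.
  rewrite -pi_cat; apply/pres_piP.
  apply: (pres_cat (u := [:: (i, b)])); last exact: pres_refl.
  apply: pres_letter_sign; apply/pres_piP.
  by have := xg_sq i; rewrite -pi_cat.
have bN := xg_bcN.
case: i => [[|[|[|//]]] i3].
- have -> : Ordinal i3 = 0 by apply: val_inj.
  by apply: has_nf_a => //; exact: xg_sq.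
- have -> : Ordinal i3 = 1 by apply: val_inj.
  by apply: has_nf_b => //; exact: xg_sq.
have -> : Ordinal i3 = 2 by apply: val_inj.
by apply: has_nf_c => //; exact: xg_sq.
Qed.

Lemma rep_dihg d : rep (dihg (xg 1) (xg 2) d) (dihmx d).
Proof.
case: d => p k; rewrite /dihg /dihmx /=; apply: repM; last first.
  by case: p; [exact: rep_xg|exact: rep1].
elim: k => [|k IH]; first exact: rep1.
by rewrite expgS exprS; apply: repM IH; apply: repM; exact: rep_xg.
Qed.

Lemma rep_nf d l : rep (nf (xg 0) (xg 1) (xg 2) d l) (nfmx R N d l).
Proof.
elim: l d => [|e l IH] d /=; first exact: rep_dihg.
by apply: repM; [exact: rep_dihg|apply: repM; [exact: rep_xg|exact: IH]].
Qed.

(** The kernel of the morphism is trivial, by normal forms and ping-pong. *)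
Lemma rep_faithful (x : G) : rep x 1%:M -> x = 1%g.
Proof.
case: (has_nf_presented x) => d [l [rl ->]] x1.
have [-> ->] := nfmx_scalar hN rl (propor_trans (propor_sym (rep_nf d l)) x1).
by rewrite /= /dihg /= expg0 mulg1.
Qed.

Definition hom_val (x : G) : pgsp J := (\pi_(pgsp J) (ev (repr x)))%qT.

Lemma ev_Gamma w : Gamma (ev w).
Proof.
elim: w => [|l w IH] H gH SH /=; first by case: gH.
apply: group_closedM => //; last exact: IH.
apply: SH; rewrite /gen; case: ifP => _; first by left; left.
by case: ifP => _; [left; right|right].
Qed.

Lemma hom_valP x : is_PGamma (hom_val x).
Proof. by apply/asboolP; exists (ev (repr x)); first exact: ev_Gamma. Qed.

Definition hom (x : G) : PGamma R N := Sub (hom_val x) (hom_valP x).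

Lemma hom_eq (x : G) (g : gsp J) : rep x (gsp_val g) ->
  hom_val x = (\pi_(pgsp J) g)%qT.
Proof. by move=> /propor_sym [c c0 E]; apply/pgsp_piP; exists c. Qed.

Lemma homM (x y : G) : hom (x * y)%g = (hom x * hom y)%g.
Proof.
apply: val_inj; rewrite /= [RHS](esym (pgsp_piM _ _)); apply: hom_eq.
by rewrite gsp_valM; apply: repM; exact: propor_refl.
Qed.

Lemma hom_inj : injective hom.
Proof.
move=> x y /(congr1 val) /= /pgsp_piP [c c0 E].
have xy : rep (x^-1 * y)%g 1%:M.
  apply: propor_trans (_ : propor _ (gsp_val (ev (repr x^-1%g)) *m gsp_val (ev (repr x)))) _.
    apply: repM; first exact: propor_refl.
    by exists c.
  have := @repM x^-1%g x _ _ (propor_refl _) (propor_refl _).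
  rewrite mulVg => /propor_sym h; exact: propor_trans h rep1.
by have /(congr1 (fun z => x * z)%g) := rep_faithful xy; rewrite mulVKg mulg1 => ->.
Qed.

(** The values of ev form a subgroup; this is used for surjectivity. *)
Lemma ev_inv w : exists w', ev w' = ((ev w)^-1)%g.
Proof.
elim: w => [|l w [w' E]]; first by exists [::]; rewrite /= invg1.
exists (w' ++ [:: l]); rewrite ev_cat E /= mulg1 invgM; congr (_ * _)%g.
by apply/esym/mulg1_eq; exact: gen_sq.
Qed.

Lemma hom_surj (y : PGamma R N) : exists x, hom x = y.
Proof.
have /asboolP [g Gg yg] := valP y.
pose H : {pred gsp J} := [pred g | `[< exists w, ev w = g >]].
have /asboolP [w wg] : g \in H.
  apply: Gg.
    split; first by apply/asboolP; exists [::].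
    move=> _ _ /asboolP[u <-] /asboolP[v <-]; apply/asboolP.
    by have [v' E] := ev_inv v; exists (u ++ v'); rewrite ev_cat E.
  by move=> _ [[]|] ->; apply/asboolP; [exists (letter 0)|exists (letter 1)|exists (letter 2)];
    rewrite /= mulg1.
exists (\pi_G w)%qT; apply: val_inj; rewrite /= yg -wg.
exact: hom_eq (rep_pi w).
Qed.

Lemma PGamma_presented : exists f : {multiplicative PGamma R N -> G}, bijective f.
Proof.
pose f0 (y : PGamma R N) : G := projT1 (cid (hom_surj y)).
have f0K : cancel f0 hom by move=> y; exact: projT2 (cid (hom_surj y)).
have Kf0 : cancel hom f0 by move=> x; apply: hom_inj; rewrite f0K.
have f0M : {morph f0 : x y / (x * y)%g}.
  by move=> x y; apply: hom_inj; rewrite homM !f0K.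
pose f : {multiplicative PGamma R N -> G} :=
  HB.pack f0 (isMultiplicative.Build _ _ f0 f0M).
by exists f, hom.
Qed.

End Hom.

Theorem theorem3p2p5 (R : realType) (N : nat) (hN : (4 <= N)%N) :
  [/\ forall (p p' : bool) (k k' : nat), (k < N)%N -> (k' < N)%N ->
        (p, k) <> (p', k') ->
        (proj_cone R N p k)° `&` (proj_cone R N p' k')° = set0,
      forall (p : bool) (k : nat), (k < N)%N -> (p, k) <> (false, 0%N) ->
        [set proj_act (gspA R N) x | x in proj_cone R N p k]
          `<=` proj_cone R N false 0
    & exists f : {multiplicative PGamma R N -> presented (coxeter_rels N)},
        bijective f].
Proof.
split.
- by move=> p p' k k' kN k'N; exact: (@proj_cone_interior_disjoint R N hN (p, k) (p', k')).
- by move=> p k; exact: proj_cone_gspA.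
exact: PGamma_presented.
Qed.
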